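(* Let $\delta_0>0$ be a sufficiently small constant and let $d_0=\lfloor\delta_0\ln n\rfloor$. Let $\tilde G=(G_i)_{i=0}^N$ be a random graph process on $n$ vertices, and let $G=G_{\tau_2}$, where $\tau_2=\tau_2(\tilde G)$ is the hitting time for having minimum degree at least $2$. Then with probability tending to $1$ as $n\to\infty$, $G$ has all of the following properties: (P1) $\Delta(G)\le 10\ln n$ and $\delta(G)\ge 2$; (P2) $|SMALL(G)|\le n^{0.3}$; (P3) $G$ does not contain a non-empty path of length at most $4$ both of whose (possibly identical) endpoints lie in $SMALL(G)$; (P4) every vertex subset $U\subset[n]$ with $|U|\le \frac{n}{\ln^{1/2}n}$ spans at most $|U|\ln^{3/4}n$ edges of $G$; (P5) for every pair of disjoint vertex subsets $U,W$ with $|U|\le\frac{n}{\ln^{1/2}n}$ and $|W|\le |U|\ln^{1/4}n$, the number of edges of $G$ between $U$ and $W$ is at most $\frac{d_0|U|}{2}$; (P6) for every pair of disjoint vertex subsets $U,W$ with $|U|=|W|=\left\lceil\frac{n}{\ln^{1/2}n}\right\rceil$, $G$ has at least $0.5n$ edges between $U$ and $W$.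
   Context: Let $N=\binom n2$. A random graph process on $n$ vertices is obtained by choosing a uniformly random ordering $(e_1,\dots,e_N)$ of the edges of the complete graph $K_n$ on vertex set $[n]$ and letting $G_i$ be the graph on $[n]$ with edge set $\{e_1,\dots,e_i\}$. For a monotone increasing graph property, its hitting time is the least $i$ such that $G_i$ has the property. For a graph $G$ on $n$ vertices, $SMALL(G)=\{v\in V(G): d_G(v)<d_0\}$. $\Delta(G)$ and $\delta(G)$ denote maximum and minimum degree. Path lengths are measured in edges. *)

(* Defs.v *)
From HB Require Import structures.
From mathcomp Require Import all_boot all_order all_algebra.
From mathcomp Require Import all_classical all_reals all_analysis.

Set Implicit Arguments.
Unset Strict Implicit.
Unset Printing Implicit Defensive.

Import Order.TTheory GRing.Theory Num.Theory.
Import numFieldNormedType.Exports.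

Local Open Scope ring_scope.

(* A graph on the vertex set 'I_n is given by its set of edges, each edge being
   a two-element set of vertices. *)
Definition graph (n : nat) := {set {set 'I_n}}.

Definition complete (n : nat) : graph n := [set e : {set 'I_n} | #|e| == 2%N].

Section Graph.
Variables (n : nat) (G : graph n).

(* Irreflexive when G \subset complete n, since [set u; u] is a singleton. *)
Definition adj : rel 'I_n := [rel u v | [set u; v] \in G].

Definition deg (v : 'I_n) : nat := #|[set e in G | v \in e]|.

Definition maxdeg : nat := \max_(v : 'I_n) deg v.

(* The default value n exceeds every degree, so it only matters for n = 0. *)
Definition mindeg : nat := \big[minn/n]_(v : 'I_n) deg v.

Definition edges_in (U : {set 'I_n}) : nat := #|[set e in G | e \subset U]|.

Definition edges_between (U W : {set 'I_n}) : nat :=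
  #|[set e in G | [exists u in U, exists w in W, e == [set u; w]]]|.

(* x :: p is a path of length size p from x to last x p. The endpoints may
   coincide, in which case x :: p traverses a cycle (of length at least 3, so
   that no edge is repeated); no other repetition of vertices is allowed. *)
Definition is_path (x : 'I_n) (p : seq 'I_n) : bool :=
  path adj x p &&
  (uniq (x :: p) || [&& (2 < size p)%N, uniq p & last x p == x]).

End Graph.

Definition edge_orderings (n : nat) : {set 'C(n, 2).-tuple {set 'I_n}} :=
  [set s : 'C(n, 2).-tuple {set 'I_n} | perm_eq s (enum (complete n))].

Definition process (n : nat) (s : 'C(n, 2).-tuple {set 'I_n}) (i : nat) :
  graph n := [set e in take i s].

(* The junk value 'C(n, 2).+1 is returned if no graph of the process has the
   property. *)
Definition hitting_time (n : nat) (P : pred (graph n))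
    (s : 'C(n, 2).-tuple {set 'I_n}) : nat :=
  find (fun i => P (process s i)) (iota 0 'C(n, 2).+1).

Definition tau2 (n : nat) (s : 'C(n, 2).-tuple {set 'I_n}) : nat :=
  hitting_time (fun G : graph n => (2 <= mindeg G)%N) s.

(* Probability that the random graph process on n vertices, i.e. a uniformly
   random ordering of the edges of the complete graph, satisfies E. *)
Definition process_prob (R : realType) (n : nat)
    (E : 'C(n, 2).-tuple {set 'I_n} -> Prop) : R :=
  #|[set s in edge_orderings n | `[< E s >]]|%:R / #|edge_orderings n|%:R.

Section Properties.
Variables (R : realType) (delta0 : R) (n : nat) (G : graph n).

Let L : R := ln n%:R.

Definition d0 : int := Num.floor (delta0 * L).

Definition SMALL : {set 'I_n} := [set v | (deg G v)%:Z < d0].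

Definition P1 : Prop := (maxdeg G)%:R <= 10 * L /\ (2 <= mindeg G)%N.

Definition P2 : Prop := #|SMALL|%:R <= n%:R `^ (3 / 10) :> R.

Definition P3 : Prop :=
  ~ exists (x : 'I_n) (p : seq 'I_n),
      [/\ is_path G x p, (0 < size p <= 4)%N, x \in SMALL & last x p \in SMALL].

Definition P4 : Prop :=
  forall U : {set 'I_n},
    #|U|%:R <= n%:R / L `^ (1 / 2) ->
    (edges_in G U)%:R <= #|U|%:R * L `^ (3 / 4).

Definition P5 : Prop :=
  forall U W : {set 'I_n}, [disjoint U & W] ->
    #|U|%:R <= n%:R / L `^ (1 / 2) ->
    #|W|%:R <= #|U|%:R * L `^ (1 / 4) ->
    (edges_between G U W)%:R <= d0%:~R * #|U|%:R / 2 :> R.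

Definition P6 : Prop :=
  forall U W : {set 'I_n}, [disjoint U & W] ->
    #|U|%:Z = Num.ceil (n%:R / L `^ (1 / 2)) ->
    #|W|%:Z = Num.ceil (n%:R / L `^ (1 / 2)) ->
    n%:R / 2 <= (edges_between G U W)%:R :> R.

End Properties.

(* Main.v *)
(* With L = ln n, the process is compared with the graphs G1 and G2 at the times
   m1 ~ 0.45 n L and m2 ~ n L. A second moment computation shows that G1 has an
   isolated vertex, and a first moment one that G2 has minimum degree at least 2,
   so that G1 <= G <= G2. Upper bounds (maximum degree, P4, P5) are then proved
   for G2, lower bounds (P6) for G1, and a short path of G between small vertices
   is a path of G2 whose ends are small in G1.

   All probability estimates come from exchanging two edges of the ordering: given
   that the edges of P come before m2 and those of S after m1, a new edge is
   equally likely to be at any of the remaining positions. This yields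
   Pr(P <= G2) <= p2 ^ |P| and, by induction on F, the exponential moment bound
   E[1_(P <= G2) z ^ |F & G1|] <= (2 p2) ^ |P| (1 - (1 - z) p1) ^ |F| for F disjoint
   from P, where p_i = m_i / N. Everything else is a union bound. *)
Require Import Defs.
From HB Require Import structures.
From mathcomp Require Import all_boot all_order all_algebra.
From mathcomp Require Import all_classical all_reals all_analysis.
From mathcomp Require Import all_fingroup zify ring lra.
(* Imported again because all_classical shadows the finite set operations. *)
From mathcomp Require Import fintype finset.
Import Order.TTheory GRing.Theory Num.Theory.
Import numFieldNormedType.Exports.
Local Open Scope ring_scope.

Set Implicit Arguments.
Unset Strict Implicit.
Unset Printing Implicit Defensive.

(** The time [tau2] depends on the degrees, so the graph at that time cannot be estimated directly.
    The property P3 shapes the proof: being neither increasing nor decreasing, it needs a joint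
    bound for edges present at the late time and edges missing at the early one, whence the two
    times in [hit_avoid]. The gap between the times costs little, since each edge of a path
    contributes only a factor of order [ln n]. The early density [0.9 * ln n / n] is a compromise.
    It is below [ln n / n], so that isolated vertices survive, yet large enough for a vertex to be
    small with probability at most [n ^ (-0.8)]. Then about [n ^ 0.2] small vertices are expected,
    below the [n ^ 0.3] of P2. For P3, up to powers of [ln n], the expected number of open paths is
    [n * n ^ (-1.6) = n ^ (-0.6)] and that of closed ones is [n ^ (-0.8)]. *)

Lemma disjoint_setU1 (T : finType) (x : T) (A B : {set T}) :
  [disjoint x |: A & B] = (x \notin B) && [disjoint A & B].
Proof.
rewrite -disjointU1; apply: eq_disjoint => y.
by rewrite !inE -topredE.
Qed.

(** * Edge orderings and the exchange of two edges *)

Section Orderings.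
Variable n : nat.
Local Notation K := (complete n).
Local Notation N := ('C(n, 2)).
Local Notation edge := {set 'I_n}.
Local Notation Om := (edge_orderings n).
Implicit Types (s : 'C(n, 2).-tuple {set 'I_n}) (e g : {set 'I_n})
  (P S : {set {set 'I_n}}).

Lemma card_complete : #|K| = N.
Proof. by rewrite card_draws card_ord. Qed.

Lemma edge_ordering_uniq s : s \in Om -> uniq s.
Proof. by rewrite inE => /perm_uniq->; exact: enum_uniq. Qed.

Lemma mem_edge_ordering s : s \in Om -> s =i K.
Proof. by rewrite inE => /perm_mem h e; rewrite h mem_enum. Qed.

Lemma edge_orderings_gt0 : (0 < #|Om|)%N.
Proof.
have h : size (enum K) == N by rewrite -cardE card_complete.
by apply/card_gt0P; exists (Tuple h); rewrite inE.
Qed.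

Lemma process_sub s m : s \in Om -> process s m \subset K.
Proof.
by move=> hs; apply/subsetP => e; rewrite inE => /mem_take; rewrite mem_edge_ordering.
Qed.

Lemma process_mono s i j : (i <= j)%N -> process s i \subset process s j.
Proof.
move=> ij; apply/subsetP => e; rewrite !inE -(take_takel _ ij) => /mem_take.
exact.
Qed.

Lemma card_process s m : s \in Om -> (m <= N)%N -> #|process s m| = m.
Proof.
move=> hs mN; rewrite cardsE; have /card_uniqP -> := take_uniq m (edge_ordering_uniq hs).
by rewrite size_take size_tuple; case: ltngtP mN.
Qed.

Lemma process_relabel (p : {perm edge}) s m e :
  (p e \in process (map_tuple p s) m) = (e \in process s m).
Proof. by rewrite !inE -map_take mem_map//; exact: perm_inj. Qed.

Lemma swap_edge_ordering e g s : e \in K -> g \in K -> s \in Om ->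
  map_tuple (tperm e g) s \in Om.
Proof.
move=> eK gK hs; rewrite inE; apply: uniq_perm; rewrite ?enum_uniq//.
  by rewrite map_inj_uniq ?edge_ordering_uniq//; exact: perm_inj.
move=> x; rewrite mem_enum -{1}(tpermK e g x) mem_map; last exact: perm_inj.
by rewrite mem_edge_ordering//; case: tpermP => [->|->|]; rewrite ?eK ?gK.
Qed.

(* Exchanging e with any g outside A preserves D, so e is equally likely to
   stand at any of the positions left free by A. *)
Lemma card_swap (D : {set 'C(n, 2).-tuple {set 'I_n}}) (A : {set {set 'I_n}})
    (Q : {set 'I_n} -> 'C(n, 2).-tuple {set 'I_n} -> bool) e :
  (forall g s, g \in K :\: A -> s \in D -> map_tuple (tperm e g) s \in D) ->
  (forall g s, Q e (map_tuple (tperm e g) s) = Q g s) ->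
  (#|[set s in D | Q e s]| * #|K :\: A| =
     \sum_(s in D) #|[set g in K :\: A | Q g s]|)%N.
Proof.
move=> closD invQ.
transitivity (\sum_(g in K :\: A) \sum_(s in D) Q g s)%N; last first.
  rewrite exchange_big /=; apply: eq_bigr => s _.
  rewrite -sum1dep_card [RHS]big_mkcondr /=.
  by apply: eq_big => [g|g _]; [rewrite inE | case: (Q g s)].
rewrite mulnC -sum_nat_const; apply: eq_bigr => g gA.
transitivity (#|[set s in D | Q g s]|); last first.
  by rewrite -sum1dep_card big_mkcondr; apply: eq_bigr => s _; case: (Q g s).
have invf : involutive (map_tuple (tperm e g) : 'C(n, 2).-tuple edge -> _).
  move=> s; apply: val_inj => /=; rewrite -map_comp -[RHS]map_id.
  by apply: eq_map => x /=; rewrite tpermK.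
rewrite -(card_preimset _ (inv_inj invf)); apply: eq_card => s.
rewrite !inE invQ; congr andb; apply/idP/idP => [|sD]; last exact: closD.
by move=> /(closD g _ gA); rewrite invf.
Qed.

(** The event conditioned on in every exchange. It constrains only the edges of [P :|: S], hence is
    stable under swapping two other edges. One-sided events are the cases [P = set0] and
    [S = set0]. *)
Definition hit_avoid m1 m2 P S : {set 'C(n, 2).-tuple {set 'I_n}} :=
  [set s in Om | (P \subset process s m2) && [disjoint S & process s m1]].

Lemma hit_avoid_swap m1 m2 P S e g s : e \in K -> g \in K ->
  e \notin P :|: S -> g \notin P :|: S ->
  s \in hit_avoid m1 m2 P S -> map_tuple (tperm e g) s \in hit_avoid m1 m2 P S.
Proof.
move=> eK gK; rewrite !in_setU !negb_or => /andP[eP eS] /andP[gP gS].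
have fix_in m x : x != e -> x != g ->
    (x \in process (map_tuple (tperm e g) s) m) = (x \in process s m).
  by move=> xe xg; rewrite -{1}(@tpermD _ e g x) 1?eq_sym// process_relabel.
rewrite ![_ \in hit_avoid _ _ _ _]inE.
move=> /and3P[hs /subsetP hP dS].
have neq x (A : {set {set 'I_n}}) y : x \in A -> y \notin A -> x != y.
  by move=> xA; apply: contraNneq => <-.
apply/and3P; split; first by have := swap_edge_ordering eK gK hs; rewrite inE.
  by apply/subsetP => x xP; rewrite fix_in ?hP// (neq _ P).
rewrite disjoint_subset; apply/subsetP => x xS.
change (x \notin process (map_tuple (tperm e g) s) m1).
by rewrite fix_in ?(disjointFr dS)// (neq _ S).
Qed.

(** By exchange, [e] is uniform over the [N - #|P :|: S|] free edges, and [P] already fills [#|P|]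
    of the first [m2] positions. This is only an inequality, because edges of [S] may fill further
    positions between [m1] and [m2]. *)
Lemma card_hit_step m1 m2 P S e : (m2 <= N)%N -> P \subset K -> S \subset K ->
  e \in K -> e \notin P -> e \notin S ->
  (#|hit_avoid m1 m2 (e |: P) S| * (N - #|P :|: S|) <=
     (m2 - #|P|) * #|hit_avoid m1 m2 P S|)%N.
Proof.
move=> m2N PK SK eK eP eS.
have ePS : e \notin P :|: S by rewrite inE negb_or eP.
have -> : (N - #|P :|: S| = #|K :\: (P :|: S)|)%N.
  by rewrite cardsDS ?card_complete// subUset PK.
have -> : hit_avoid m1 m2 (e |: P) S =
    [set s in hit_avoid m1 m2 P S | e \in process s m2].
  apply/setP => s; rewrite ![in RHS]inE [LHS]inE subUset sub1set !inE.
  by rewrite -!andbA; congr andb; rewrite andbC -andbA; congr andb; rewrite andbC.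
rewrite (@card_swap _ _ (fun g s => g \in process s m2)); last 2 first.
- move=> g s; rewrite !in_setD => /andP[gPS gK]; exact: hit_avoid_swap.
- by move=> g s; rewrite -{1}(tpermR e g) process_relabel.
rewrite mulnC -sum_nat_const; apply: leq_sum => s; rewrite inE => /and3P[hs hP _].
rewrite -{2}(card_process hs m2N) -cardsDS//; apply: subset_leq_card.
by apply/subsetP => g; rewrite 2!inE => /andP[]; rewrite !inE negb_or => /andP[/andP[-> _] _] ->.
Qed.

(** Here the count is exact, [S] being disjoint from the first [m] edges. Equality is what later
    allows a lower bound on the mean number of isolated vertices. *)
Lemma card_avoid_step m S e : (m <= N)%N -> S \subset K -> e \in K -> e \notin S ->
  (#|hit_avoid m 0 set0 (e |: S)| * (N - #|S|) =
     (N - m - #|S|) * #|hit_avoid m 0 set0 S|)%N.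
Proof.
move=> mN SK eK eS.
have eS0 : e \notin set0 :|: S by rewrite set0U.
have -> : (N - #|S| = #|K :\: (set0 :|: S)|)%N.
  by rewrite set0U cardsDS ?card_complete.
have -> : hit_avoid m 0 set0 (e |: S) =
    [set s in hit_avoid m 0 set0 S | e \notin process s m].
  apply/setP => s; rewrite ![in RHS]inE [LHS]inE disjoint_setU1 !inE.
  by rewrite -!andbA; do 2 congr andb; rewrite andbC.
rewrite (@card_swap _ _ (fun g s => g \notin process s m)); last 2 first.
- move=> g s; rewrite !in_setD => /andP[gPS gK]; exact: hit_avoid_swap.
- by move=> g s; rewrite -{1}(tpermR e g) process_relabel.
rewrite mulnC -sum_nat_const; apply: eq_bigr => s; rewrite inE => /and3P[hs _ dS].
have -> : (N - m - #|S| = #|K| - #|S :|: process s m|)%N.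
  rewrite card_complete -subnDA -[in LHS](card_process hs mN); congr subn.
  by apply/esym/eqP; rewrite addnC (leq_card_setU _ _).
rewrite -cardsDS; last by rewrite subUset SK process_sub.
apply: eq_card => g; rewrite !inE /= negb_or.
by case: (g \in S) => //=; rewrite andbC.
Qed.

End Orderings.

(** * Expectations, probabilities and tail bounds for sets of edges *)

Section ProcessProbability.
Variables (R : realType) (n : nat).
Local Notation K := (complete n).
Local Notation N := ('C(n, 2)).
Local Notation Om := (edge_orderings n).
Local Notation tuples := ('C(n, 2).-tuple {set 'I_n}).
Implicit Types (s : tuples) (P S F : {set {set 'I_n}}) (E : tuples -> Prop).

Definition process_expect (f : tuples -> R) : R :=
  (\sum_(s in Om) f s) / #|Om|%:R.
Local Notation Ex := process_expect.

Lemma card_edge_orderings_gt0 : 0 < #|Om|%:R :> R.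
Proof. by rewrite ltr0n edge_orderings_gt0. Qed.

Lemma process_expect_le f g : (forall s, s \in Om -> f s <= g s) -> Ex f <= Ex g.
Proof. by move=> fg; rewrite ler_pM2r ?invr_gt0 ?card_edge_orderings_gt0//; exact: ler_sum. Qed.

Lemma process_expect_eq f g : (forall s, s \in Om -> f s = g s) -> Ex f = Ex g.
Proof. by move=> fg; congr (_ / _); exact: eq_bigr. Qed.

Lemma process_expectZ c f : Ex (fun s => c * f s) = c * Ex f.
Proof. by rewrite /Ex -mulr_sumr mulrA. Qed.

Lemma process_expectD f g : Ex (fun s => f s + g s) = Ex f + Ex g.
Proof. by rewrite /Ex big_split mulrDl. Qed.

Lemma process_expect_cst c : Ex (fun=> c) = c.
Proof. by rewrite /Ex sumr_const -[c *+ _]mulr_natr mulfK// gt_eqF ?card_edge_orderings_gt0. Qed.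

Lemma process_expect_sum (I : finType) (A : pred I) (f : I -> tuples -> R) :
  Ex (fun s => \sum_(i | A i) f i s) = \sum_(i | A i) Ex (f i).
Proof. by rewrite /Ex exchange_big /= mulr_suml. Qed.

Lemma process_probE E : process_prob R E = Ex (fun s => `[< E s >]%:R).
Proof.
rewrite /process_prob /Ex; congr (_ / _).
rewrite -sum1dep_card natr_sum big_mkcondr /=.
by apply: eq_bigr => s _; case: ifP.
Qed.

Lemma process_prob_ge0 E : 0 <= process_prob R E.
Proof. by rewrite divr_ge0. Qed.

Lemma process_prob_le_expect E f : (forall s, s \in Om -> 0 <= f s) ->
  (forall s, s \in Om -> E s -> 1 <= f s) -> process_prob R E <= Ex f.
Proof.
move=> f0 f1; rewrite process_probE; apply: process_expect_le => s hs.
by case: asboolP => h; [exact: f1 | exact: f0].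
Qed.

Lemma process_prob_mono E1 E2 : (forall s, s \in Om -> E1 s -> E2 s) ->
  process_prob R E1 <= process_prob R E2.
Proof.
move=> h; rewrite [leRHS]process_probE; apply: process_prob_le_expect => // s hs e1.
by rewrite asboolT//; exact: h.
Qed.

Lemma process_prob_union (I : finType) (A : pred I) (E : I -> tuples -> Prop) :
  process_prob R (fun s => exists2 i, A i & E i s) <=
  \sum_(i | A i) process_prob R (E i).
Proof.
under eq_bigr do rewrite process_probE.
rewrite -process_expect_sum; apply: process_prob_le_expect => s _.
  exact: sumr_ge0.
by case=> i Ai Ei; rewrite (bigD1 i)//= asboolT// lerDl sumr_ge0.
Qed.

Lemma process_prob_or E1 E2 :
  process_prob R (fun s => E1 s \/ E2 s) <= process_prob R E1 + process_prob R E2.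
Proof.
rewrite !process_probE -process_expectD; apply: process_expect_le => s _.
by case: asboolP => [[e|e]|_]; rewrite ?(asboolT e) ?lerDl ?lerDr ?addr_ge0.
Qed.

Lemma process_prob_compl E : process_prob R E = 1 - process_prob R (fun s => ~ E s).
Proof.
rewrite !process_probE -[X in X - _](process_expect_cst 1) -[in RHS]mulN1r.
rewrite -process_expectZ -process_expectD; apply: process_expect_eq => s _.
by rewrite asbool_neg; case: asboolP => _ /=; rewrite mulN1r ?subr0 ?subrr.
Qed.

Lemma process_prob_bool (b : pred tuples) :
  process_prob R b = #|[set s in Om | b s]|%:R / #|Om|%:R.
Proof.
by congr (_%:R / _); apply: eq_card => s; rewrite !inE asboolb.
Qed.

(* The probability that the first m of M edges avoid j given ones. *)
Definition avoid_ratio (M m j : nat) : R :=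
  \prod_(i < j) ((M - m - i)%:R / (M - i)%:R).

Lemma avoid_ratioS M m j : avoid_ratio M m j.+1 =
  avoid_ratio M m j * ((M - m - j)%:R / (M - j)%:R).
Proof. by rewrite /avoid_ratio big_ord_recr. Qed.

Lemma avoid_ratio_ge0 M m j : 0 <= avoid_ratio M m j.
Proof. by apply: prodr_ge0 => i _; rewrite divr_ge0. Qed.

Lemma process_prob_avoid m S : (m <= N)%N -> S \subset K ->
  process_prob R (fun s => [disjoint S & process s m]) = avoid_ratio N m #|S|.
Proof.
move=> mN; rewrite process_prob_bool.
suff h : forall k S, #|S| = k -> S \subset K ->
    #|hit_avoid m 0 set0 S|%:R = avoid_ratio N m k * #|Om|%:R :> R.
  move=> SK; rewrite -(mulfK (lt0r_neq0 card_edge_orderings_gt0) (avoid_ratio _ _ _)) -(h _ S)//.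
  by congr (_%:R / _); apply: eq_card => s; rewrite !inE sub0set.
elim=> [|k IH] {}S cS SK.
  move/eqP: cS; rewrite cards_eq0 => /eqP ->; rewrite /avoid_ratio big_ord0 mul1r.
  congr _%:R; apply: eq_card => s; rewrite !inE sub0set /=.
  by rewrite -setI_eq0 set0I eqxx andbT.
have /card_gt0P[e eS] : (0 < #|S|)%N by rewrite cS.
have cS' : #|S :\ e| = k by move: cS; rewrite (cardsD1 e) eS => -[].
have S'K : S :\ e \subset K by apply: subset_trans SK; rewrite subsetDl.
have eK := fintype.subsetP SK e eS.
have kN : (k < N)%N by rewrite -cS -card_complete subset_leq_card.
have := card_avoid_step mN S'K eK (negbT (setD11 e S)); rewrite setD1K// cS'.
move=> /(congr1 (fun j => j%:R : R)); rewrite !natrM (IH (S :\ e))// => h.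
have kN0 : (N - k)%:R != 0 :> R by rewrite pnatr_eq0 subn_eq0 -ltnNge.
apply: (mulIf kN0); rewrite h avoid_ratioS; field; exact: kN0.
Qed.

Lemma avoid_ratio_le M m j : (m <= M)%N -> (j <= M)%N ->
  avoid_ratio M m j <= (1 - m%:R / M%:R) ^+ j.
Proof.
move=> mM; elim: j => [|j IH] sM; first by rewrite /avoid_ratio big_ord0.
have M0 : 0 < M%:R :> R by rewrite ltr0n (leq_ltn_trans _ sM).
rewrite avoid_ratioS exprSr ler_pM ?avoid_ratio_ge0 ?divr_ge0 ?IH ?(ltnW sM)//.
have -> : 1 - m%:R / M%:R = (M - m)%:R / M%:R :> R by rewrite natrB//; field; lra.
rewrite ler_pdivrMr ?ltr0n ?subn_gt0// mulrAC ler_pdivlMr// -!natrM ler_nat.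
by rewrite mulnBl mulnBr leq_sub2l// mulnC leq_mul2l leq_subr orbT.
Qed.

Lemma hit_avoid_step_le m1 m2 P S e : (m2 <= N)%N -> P \subset K -> S \subset K ->
  e \in K -> e \notin P -> e \notin S -> (#|P :|: S| < N)%N ->
  #|hit_avoid m1 m2 (e |: P) S|%:R <=
   (m2 - #|P|)%:R / (N - #|P :|: S|)%:R * #|hit_avoid m1 m2 P S|%:R :> R.
Proof.
move=> m2N PK SK eK eP eS PSN; rewrite mulrAC ler_pdivlMr ?ltr0n ?subn_gt0//.
by rewrite -!natrM ler_nat card_hit_step.
Qed.

Lemma process_prob_hit m P : (m <= N)%N -> P \subset K ->
  process_prob R (fun s => P \subset process s m) <= (m%:R / N%:R) ^+ #|P|.
Proof.
move=> mN; rewrite process_prob_bool.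
suff h : forall k P, #|P| = k -> P \subset K ->
    #|hit_avoid 0 m P set0|%:R <= (m%:R / N%:R) ^+ k * #|Om|%:R :> R.
  move=> PK; rewrite ler_pdivrMr ?card_edge_orderings_gt0//; apply: le_trans (h _ P _ PK) => //.
  rewrite ler_nat subset_leq_card//; apply/fintype.subsetP => s; rewrite !inE.
  by rewrite -setI_eq0 set0I eqxx andbT.
elim=> [|k IH] {}P cP PK.
  rewrite expr0 mul1r ler_nat subset_leq_card//; apply/fintype.subsetP => s.
  by rewrite inE => /andP[].
have /card_gt0P[e eP] : (0 < #|P|)%N by rewrite cP.
have cP' : #|P :\ e| = k by move: cP; rewrite (cardsD1 e) eP => -[].
have P'K : P :\ e \subset K by apply: subset_trans PK; rewrite subsetDl.
have eK := fintype.subsetP PK e eP.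
have kN : (k < N)%N by rewrite -cP -card_complete subset_leq_card.
have N0 : 0 < N%:R :> R by rewrite ltr0n (leq_ltn_trans _ kN).
have := @hit_avoid_step_le 0 m (P :\ e) set0 e mN P'K (sub0set _) eK (negbT (setD11 e P)).
rewrite setD1K// setU0 cP' inE => /(_ isT kN) h; apply: le_trans h _.
rewrite exprS -[leRHS]mulrA ler_pM ?divr_ge0 ?IH//.
rewrite ler_pdivrMr ?ltr0n ?subn_gt0// mulrAC ler_pdivlMr// -!natrM ler_nat.
by rewrite mulnBl mulnBr leq_sub2l// mulnC leq_mul2l mN orbT.
Qed.

(** The set [S] alone contributes an [avoid_ratio]; the edges of [P] are then added one at a time.
    Each costs at most [m2 / (N - #|P| - #|S|)], and as at most half of the edges are involved this
    is at most [2 * m2 / N], the origin of the factor [2]. *)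
Lemma card_hit_avoid_le m1 m2 P S : (m1 <= N)%N -> (m2 <= N)%N ->
  P \subset K -> S \subset K -> [disjoint P & S] -> (2 * (#|P| + #|S|) <= N)%N ->
  #|hit_avoid m1 m2 P S|%:R <=
   (2 * m2%:R / N%:R) ^+ #|P| * (1 - m1%:R / N%:R) ^+ #|S| * #|Om|%:R :> R.
Proof.
move=> m1N m2N; move: P.
suff h : forall k P, #|P| = k -> P \subset K -> S \subset K -> [disjoint P & S] ->
   (2 * (k + #|S|) <= N)%N -> #|hit_avoid m1 m2 P S|%:R <=
   (2 * m2%:R / N%:R) ^+ k * (1 - m1%:R / N%:R) ^+ #|S| * #|Om|%:R :> R.
  by move=> P PK SK dPS; exact: h.
elim=> [|k IH] P cP PK SK dPS hN.
  rewrite expr0 mul1r; move/eqP: cP; rewrite cards_eq0 => /eqP ->.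
  apply: le_trans (_ : avoid_ratio N m1 #|S| * #|Om|%:R <= _); last first.
    by rewrite ler_pM2r ?card_edge_orderings_gt0// avoid_ratio_le//; clear -hN; lia.
  rewrite -process_prob_avoid// process_prob_bool divfK ?gt_eqF ?card_edge_orderings_gt0//.
  rewrite ler_nat subset_leq_card//; apply/fintype.subsetP => s; rewrite !inE.
  by rewrite sub0set.
have /card_gt0P[e eP] : (0 < #|P|)%N by rewrite cP.
have cP' : #|P :\ e| = k by move: cP; rewrite (cardsD1 e) eP => -[].
have P'K : P :\ e \subset K by apply: subset_trans PK; rewrite subsetDl.
have eK := fintype.subsetP PK e eP.
have eS : e \notin S by rewrite (disjointFr dPS eP).
have dP'S : [disjoint P :\ e & S] by apply: disjointWl dPS; rewrite subsetDl.
have cU : #|P :\ e :|: S| = (k + #|S|)%N.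
  by rewrite -cP'; apply/eqP; rewrite (leq_card_setU _ _).
have kN : (k + #|S| < N)%N by clear -hN; lia.
have N0 : 0 < N%:R :> R by rewrite ltr0n (leq_ltn_trans _ kN).
have := @hit_avoid_step_le m1 m2 (P :\ e) S e m2N P'K SK eK (negbT (setD11 e P)) eS.
rewrite setD1K// cU cP' => /(_ kN) h; apply: le_trans h _.
rewrite exprS -2![leRHS]mulrA ler_pM ?divr_ge0//; last first.
  by rewrite mulrA IH//; clear -hN; lia.
rewrite ler_pdivrMr ?ltr0n ?subn_gt0// mulrAC ler_pdivlMr// -!natrM ler_nat.
by rewrite -mulnA mulnCA leq_mul ?leq_subr//; clear -hN; lia.
Qed.

(** Union bound over the [t]-element subsets of [F]. *)
Lemma process_prob_card_ge m F t : (m <= N)%N -> F \subset K ->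
  process_prob R (fun s => (t <= #|F :&: process s m|)%N) <=
  'C(#|F|, t)%:R * (m%:R / N%:R) ^+ t.
Proof.
move=> mN FK.
apply: le_trans (_ : \sum_(P in [set P : {set {set 'I_n}} | P \subset F & #|P| == t])
   process_prob R (fun s => P \subset process s m) <= _); last first.
  rewrite -cards_draws -sum1_card natr_sum mulr_suml; apply: ler_sum => P.
  rewrite inE => /andP[PF /eqP <-]; rewrite mul1r process_prob_hit//.
  exact: subset_trans PF FK.
apply: le_trans (process_prob_union _ _); apply: process_prob_mono => s _ /=.
move=> /card_geqP [r [ur sr hr]]; exists [set x in r].
  rewrite inE cardsE -sr; apply/andP; split; last by apply/eqP/card_uniqP.
  by apply/fintype.subsetP => x; rewrite inE => /hr; rewrite inE => /andP[].
by apply/fintype.subsetP => x; rewrite inE => /hr; rewrite inE => /andP[].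
Qed.

(* The exponential moment of #|F :&: process s m1| is bounded one edge of F at
   a time, by z ^+ (e \in G) = z + (1 - z) * (e \notin G). *)
Lemma sum_exp_card_process m1 m2 P F S (z : R) : 0 <= z <= 1 ->
  (m1 <= N)%N -> (m2 <= N)%N -> P \subset K -> S \subset K -> F \subset K ->
  [disjoint P & S] -> [disjoint P & F] -> [disjoint S & F] ->
  (2 * (#|P| + #|S| + #|F|) <= N)%N ->
  \sum_(s in hit_avoid m1 m2 P S) z ^+ #|F :&: process s m1| <=
  (2 * m2%:R / N%:R) ^+ #|P| * (1 - m1%:R / N%:R) ^+ #|S| *
  (1 - (1 - z) * (m1%:R / N%:R)) ^+ #|F| * #|Om|%:R.
Proof.
move=> /andP[z0 z1] m1N m2N PK; move: S.
have [f] := ubnP #|F|; elim: f F => // f IH F Ff S SK FK dPS dPF dSF hN.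
have [F0|/set0Pn[e eF]] := eqVneq F set0.
  rewrite F0 cards0 expr0 mulr1.
  under eq_bigr do rewrite set0I cards0 expr0.
  by rewrite sumr_const; apply: card_hit_avoid_le => //; clear -hN; lia.
have eK := fintype.subsetP FK e eF.
have cF : #|F| = #|F :\ e|.+1 by rewrite (cardsD1 e) eF.
have eS : e \notin S by rewrite (disjointFl dSF eF).
have eP : e \notin P by rewrite (disjointFl dPF eF).
have sF : F :\ e \subset F by rewrite subsetDl.
have F'K : F :\ e \subset K by apply: subset_trans FK.
have dPF' : [disjoint P & F :\ e] by apply: disjointWr dPF.
have dSF' : [disjoint S & F :\ e] by apply: disjointWr dSF.
have cS : #|e |: S| = #|S|.+1 by rewrite cardsU1 eS.
have hE s : z ^+ #|F :&: process s m1| =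
   z ^+ #|(F :\ e) :&: process s m1| * (z + (1 - z) * (e \notin process s m1)%:R).
  rewrite (cardsD1 e (F :&: _)) inE eF /= -setIDAC.
  case: (e \in process s m1) => /=.
    by rewrite exprS mulr0 addr0 mulrC.
  by rewrite add0n mulr1 addrC subrK mulr1.
under eq_bigr do rewrite hE mulrDr.
rewrite big_split /= -mulr_suml.
have -> : \sum_(s in hit_avoid m1 m2 P S)
    z ^+ #|(F :\ e) :&: process s m1| * ((1 - z) * (e \notin process s m1)%:R) =
  (\sum_(s in hit_avoid m1 m2 P (e |: S)) z ^+ #|(F :\ e) :&: process s m1|) * (1 - z).
  rewrite mulr_suml [RHS]big_mkcond [LHS]big_mkcond /=; apply: eq_bigr => s _.
  rewrite !(inE, disjoint_setU1).
  case: (perm_eq _ _) => //=; case: (P \subset _) => //=.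
  by case: (e \in take _ _) => /=; case: [disjoint S & _] => //=; rewrite ?mulr0// mulr1.
have F'f : (#|F :\ e| < f)%N by clear -Ff cF; lia.
have bS : (2 * (#|P| + #|S| + #|F :\ e|) <= N)%N by clear -hN cF; lia.
have beS : (2 * (#|P| + #|e |: S| + #|F :\ e|) <= N)%N by rewrite cS; clear -hN cF; lia.
have eSK : e |: S \subset K by rewrite subUset sub1set eK.
have dPeS : [disjoint P & e |: S] by rewrite disjoint_sym disjoint_setU1 eP disjoint_sym.
have deSF' : [disjoint e |: S & F :\ e] by rewrite disjoint_setU1 setD11.
have z1' : 0 <= 1 - z by rewrite subr_ge0.
apply: le_trans (lerD (ler_wpM2r z0 (IH _ F'f S SK F'K dPS dPF' dSF' bS))
   (ler_wpM2r z1' (IH _ F'f _ eSK F'K dPeS dPF' deSF' beS))) _.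
(* The two terms combine because [z + (1 - z) * (1 - p) = 1 - (1 - z) * p]. *)
rewrite cS cF !exprS le_eqVlt; apply/orP; left; apply/eqP.
set a := _ ^+ #|P|; set p : R := m1%:R / N%:R; set b := _ ^+ #|S|.
set c := _ ^+ #|F :\ e|; set d : R := #|Om|%:R.
by move: p a d b c => p a d b c; ring.
Qed.

(** Chernoff's method: on the event, [z ^- d * z ^+ #|F :&: process s m1|] is at least [1], so
    Markov's inequality reduces to the exponential moment. Then [1 - x <= expR (- x)] is applied to
    each edge of [F]. *)
Lemma process_prob_hit_card_le m1 m2 P F (z : R) d : 0 < z <= 1 ->
  (m1 <= N)%N -> (m2 <= N)%N -> P \subset K -> F \subset K ->
  [disjoint P & F] -> (2 * (#|P| + #|F|) <= N)%N ->
  process_prob R (fun s => P \subset process s m2 /\ (#|F :&: process s m1| <= d)%N) <=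
  z ^- d * (2 * m2%:R / N%:R) ^+ #|P| *
    expR (- ((1 - z) * (m1%:R / N%:R) * #|F|%:R)).
Proof.
move=> /andP[z0 z1] m1N m2N PK FK dPF hN.
have p1 : m1%:R / N%:R <= 1 :> R.
  have [->|N0] := posnP N; first by rewrite invr0 mulr0.
  by rewrite ler_pdivrMr ?ltr0n// mul1r ler_nat.
have b0 : 0 <= 1 - (1 - z) * (m1%:R / N%:R).
  by rewrite subr_ge0 mulr_ile1 ?divr_ge0//; lra.
have := @sum_exp_card_process m1 m2 P F set0 z _ m1N m2N PK (sub0set _) FK _ dPF _ _.
rewrite (ltW z0) z1 cards0 addn0 expr0 mulr1 disjoint_sym -!setI_eq0 !set0I eqxx.
move=> /(_ isT isT isT hN) hM.
apply: le_trans (_ : z ^- d * ((2 * m2%:R / N%:R) ^+ #|P| *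
    (1 - (1 - z) * (m1%:R / N%:R)) ^+ #|F|) <= _); last first.
  rewrite -[leRHS]mulrA ler_wpM2l ?invr_ge0 ?exprn_ge0 ?(ltW z0)//.
  rewrite ler_wpM2l ?exprn_ge0 ?divr_ge0 ?mulr_ge0//.
  rewrite -[X in expR X]mulNr expRM_natr lerXn2r ?nnegrE ?expR_ge0//.
  exact: expR_ge1Dx.
rewrite -(ler_pM2r card_edge_orderings_gt0) -[leRHS]mulrA.
apply: le_trans (ler_wpM2l _ hM); last by rewrite invr_ge0 exprn_ge0 ?ltW.
rewrite mulr_sumr /process_prob divfK ?gt_eqF ?card_edge_orderings_gt0//.
rewrite -sum1_card natr_sum [leLHS]big_mkcond [leRHS]big_mkcond /=.
apply: ler_sum => s _; rewrite !inE -setI_eq0 set0I eqxx andbT.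
case: asboolP => [[-> hd]|_]; case: (perm_eq _ _) => //=.
  by rewrite ler_pdivlMl ?exprn_gt0// mulr1 ler_wiXn2l ?(ltW z0).
by case: ifP => // _; rewrite mulr_ge0 ?invr_ge0 ?exprn_ge0 ?(ltW z0).
Qed.

End ProcessProbability.

(** * Stars, edges between vertex sets, and paths *)

Section GraphFacts.
Variable n : nat.
Local Notation K := (complete n).
Implicit Types (G H : graph n) (x y v w : 'I_n) (U V W : {set 'I_n}) (p : seq 'I_n).

Lemma pair_in_complete x y : x != y -> [set x; y] \in K.
Proof. by move=> xy; rewrite inE cards2 xy. Qed.

Lemma complete_pair e v : e \in K -> v \in e -> exists2 w, w != v & e = [set v; w].
Proof.
rewrite inE => /cards2P[a [b [ab ->]]]; rewrite !inE => /orP[] /eqP ->.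
  by exists b; rewrite // eq_sym.
by exists a; rewrite // setUC.
Qed.

(** Leaving out [V] decouples degrees from paths: when [V] is the vertex set of a path, the stars at
    its ends are disjoint from each other and from the path. All edges at [x] are obtained with [V =
    [set x]]. *)
Definition fan x V : {set {set 'I_n}} := [set [set x; v] | v in ~: V].

Lemma in_fan_notin x V v e : e \in fan x V -> v \in V -> v != x -> v \notin e.
Proof.
case/imsetP => w; rewrite inE => wV -> vV vx; rewrite !inE negb_or vx.
by apply: contraNneq wV => <-.
Qed.

Lemma fan_sub_complete x V : x \in V -> fan x V \subset K.
Proof.
move=> xV; apply/fintype.subsetP => e /imsetP[v]; rewrite inE => vV ->.
by apply: pair_in_complete; apply: contraNneq vV => <-.
Qed.

Lemma card_fan x V : x \in V -> #|fan x V| = (n - #|V|)%N.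
Proof.
move=> xV; rewrite card_in_imset; first by have := cardsC V; rewrite card_ord => E; rewrite -[X in (X - _)%N]E addKn.
move=> v w.
rewrite !inE => vV wV /setP /(_ v); rewrite !inE eqxx orbT => /esym/orP[]/eqP// vx.
by rewrite vx xV in vV.
Qed.

Lemma card_fan_le_deg G x V : (#|fan x V :&: G| <= deg G x)%N.
Proof.
apply: subset_leq_card; apply/fintype.subsetP => e; rewrite !inE => /andP[].
by case/imsetP => v _ -> ->; rewrite !inE eqxx.
Qed.

Lemma degE G x : G \subset K -> deg G x = #|fan x [set x] :&: G|.
Proof.
move=> GK; apply/eqP; rewrite eqn_leq card_fan_le_deg andbT.
apply: subset_leq_card; apply/fintype.subsetP => e; rewrite !inE => /andP[eG xe].
rewrite eG andbT; have [w wx ->] := complete_pair (fintype.subsetP GK e eG) xe.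
by apply/imsetP; exists w; rewrite // !inE.
Qed.

Lemma disjoint_fan x y V : x != y -> x \in V -> y \in V ->
  [disjoint fan x V & fan y V].
Proof.
move=> xy xV yV; apply/pred0P => e /=; apply/negbTE/negP => /andP[ex ey].
have := in_fan_notin ey xV xy.
by case/imsetP: ex => v _ ->; rewrite !inE eqxx.
Qed.

Lemma deg0_disjoint G x : G \subset K -> (deg G x == 0%N) = [disjoint fan x [set x] & G].
Proof. by move=> GK; rewrite degE// cards_eq0 setI_eq0. Qed.

Lemma deg_mono G H x : G \subset H -> (deg G x <= deg H x)%N.
Proof.
move=> /fintype.subsetP GH; apply/subset_leq_card/fintype.subsetP => e; rewrite !inE.
by move=> /andP[/GH-> ->].
Qed.

Lemma deg_le_maxdeg G x : (deg G x <= maxdeg G)%N.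
Proof. exact: (leq_bigmax x). Qed.

Lemma maxdeg_leP G d : reflect (forall x, (deg G x <= d)%N) (maxdeg G <= d)%N.
Proof. by apply: (iffP (bigop.bigmax_leqP _ _ _)) => h x //; exact: h. Qed.

Lemma mindegP G d : (d <= n)%N -> reflect (forall x, (d <= deg G x)%N) (d <= mindeg G)%N.
Proof.
move=> dn; apply: (iffP idP) => [h x|h].
  apply: leq_trans h _; rewrite /mindeg.
  elim: (index_enum _) (mem_index_enum x) => //= v r IH.
  by rewrite inE big_cons geq_min => /orP[/eqP ->|/IH ->]; rewrite ?leqnn ?orbT.
by rewrite /mindeg; elim/big_ind: _ => // a b da db; rewrite leq_min da.
Qed.

Lemma edges_between_mono G H U W : G \subset H ->
  (edges_between G U W <= edges_between H U W)%N.
Proof.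
move=> /fintype.subsetP GH; apply/subset_leq_card/fintype.subsetP => e.
by rewrite !inE => /andP[/GH-> ->].
Qed.

Lemma edges_between_monoW G U W W' : W \subset W' ->
  (edges_between G U W <= edges_between G U W')%N.
Proof.
move=> /fintype.subsetP WW; apply/subset_leq_card/fintype.subsetP => e.
rewrite !inE => /andP[-> /existsP[u /andP[uU /existsP[w /andP[/WW wW ew]]]]].
by apply/existsP; exists u; rewrite uU; apply/existsP; exists w; rewrite wW.
Qed.

Lemma edges_in_le_between G U : G \subset K -> (edges_in G U <= edges_between G U U)%N.
Proof.
move=> /fintype.subsetP GK; apply/subset_leq_card/fintype.subsetP => e.
rewrite !inE => /andP[eG eU]; rewrite eG /=; move: (GK e eG) eU; rewrite inE.
case/cards2P => a [b [ab ->]]; rewrite subUset !sub1set => /andP[aU bU].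
by apply/existsP; exists a; rewrite aU; apply/existsP; exists b; rewrite bU eqxx.
Qed.

(** Intersecting with [K] discards the singletons that arise when [U] and [W] meet; P4 is treated
    with [W = U]. *)
Definition cross U W : {set {set 'I_n}} := [set [set u; w] | u in U, w in W] :&: K.

Lemma edges_betweenE G U W : G \subset K -> edges_between G U W = #|cross U W :&: G|.
Proof.
move=> /fintype.subsetP GK; apply: eq_card => e; rewrite [LHS]inE /cross setIC setIA inE.
apply/idP/idP.
  move=> /andP[eG /existsP[u /andP[uU /existsP[w /andP[wW /eqP ew]]]]].
  rewrite in_setI eG GK// andbT /=; apply/imset2P; exact: (Imset2spec uU wW).
rewrite in_setI => /andP[/andP[eG]].
case/imset2P => u w uU wW ew _; rewrite eG; apply/existsP; exists u; rewrite uU /=.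
by apply/existsP; exists w; rewrite wW ew eqxx.
Qed.

Lemma card_cross_le U W : (#|cross U W| <= #|U| * #|W|)%N.
Proof.
apply: leq_trans (subset_leq_card (subsetIl _ _)) _.
by rewrite curry_imset2X -cardsX leq_imset_card.
Qed.

Lemma card_cross U W : [disjoint U & W] -> #|cross U W| = (#|U| * #|W|)%N.
Proof.
move=> dUW; rewrite /cross (setIidPl _).
  rewrite curry_imset2X card_in_imset ?cardsX// => -[u w] [u' w'].
  rewrite !inE /= => /andP[uU wW] /andP[uU' wW'] E.
  have uw a b : a \in U -> b \in W -> a != b.
    by move=> aU bW; apply: contraTneq bW => <-; rewrite (disjointFr dUW aU).
  congr pair.
    by move/setP: E => /(_ u); rewrite !inE eqxx (negbTE (uw _ _ uU wW')) orbF => /esym/eqP.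
  move/setP: E => /(_ w); rewrite !inE eqxx orbT eq_sym (negbTE (uw _ _ uU' wW)) /=.
  by move=> /esym/eqP.
apply/fintype.subsetP => e /imset2P[u w uU wW ->]; apply: pair_in_complete.
by apply: contraTneq wW => <-; rewrite (disjointFr dUW uU).
Qed.

Definition path_edges x p : seq {set 'I_n} := pairmap (fun a b => [set a; b]) x p.

Lemma path_edges_in G x p : path (adj G) x p -> {subset path_edges x p <= G}.
Proof.
elim: p x => [|y p IH] x //= /andP[xy /IH h] e; rewrite inE => /orP[/eqP->//|]; exact: h.
Qed.

Lemma path_edges_sub x p e : e \in path_edges x p -> {subset e <= x :: p}.
Proof.
elim: p x => [|y p IH] x //=; rewrite inE => /orP[/eqP-> v|/IH h v /h].
  by rewrite !inE => /orP[]->; rewrite ?orbT.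
by rewrite [v \in x :: _]inE => ->; rewrite orbT.
Qed.

Lemma path_edges_uniq x p : uniq (x :: p) -> uniq (path_edges x p).
Proof.
elim: p x => [|y p IH] x // /andP[xp up]; rewrite /= (IH y up) andbT.
by apply: contra xp => /path_edges_sub; apply; rewrite !inE eqxx.
Qed.

(** Since [p] is a simple path, only the first edge needs care. It contains [y], which later occurs
    only in the edge from [y] to [z]; equality with that edge would put [x] among [y] and [z],
    whereas [x] ends [p], strictly after both. *)
Lemma cycle_edges_uniq x p : (2 < size p)%N -> uniq p -> last x p = x ->
  uniq (path_edges x p).
Proof.
case: p => [|y [|z [|t p]]]// _ up lx; rewrite [path_edges _ _]/= cons_uniq.
rewrite [X in _ && X](path_edges_uniq up) andbT.
have xtp : x \in t :: p by rewrite -[X in X \in _]lx /= mem_last.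
move: up => /= /and3P[]; rewrite !inE !negb_or.
move=> /and3P[yz yt yp] /andP[zt zp] _.
have nin h : [set x; y] \in path_edges z (t :: p) -> h.
  move=> /(@path_edges_sub z (t :: p)) /(_ y).
  by rewrite !inE eqxx orbT (negbTE yz) (negbTE yt) (negbTE yp) => /(_ isT).
apply/and3P; split; last 2 first.
- by apply/negP => h; apply: nin; rewrite /= inE h.
- by apply/negP => h; apply: nin; rewrite /= inE h orbT.
apply/eqP => E.
have : x \in [set y; z] by rewrite -E !inE eqxx.
by rewrite !inE => /orP[]/eqP xE; move: xtp; rewrite xE !inE ?(negbTE yt) ?(negbTE zt)
  ?(negbTE yp) ?(negbTE zp).
Qed.

End GraphFacts.

(** * Numerical estimates for exponentials and binomial coefficients *)

Section NumericBounds.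
Variable R : realType.
Implicit Types x y : R.

Lemma expR1_le3 : expR 1 <= 3 :> R.
Proof.
(* Sixth power of [1 - 1/6 <= expR (- (1/6))]; six is enough, as [(5/6) ^ 6] exceeds [1/3]. *)
have h : (5 / 6) ^+ 6 <= expR (- 1) :> R.
  have -> : - 1 = (- (1 / 6)) * 6%:R :> R by field.
  rewrite expRM_natr lerXn2r ?nnegrE ?expR_ge0//.
  by apply: le_trans (expR_ge1Dx _); lra.
rewrite -[leLHS]invrK -expRN -[leRHS]invrK lef_pV2 ?posrE ?expR_gt0//.
by apply: le_trans h; lra.
Qed.

Lemma expRN_le_inv x : 0 < x -> expR (- x) <= x^-1.
Proof.
move=> x0; rewrite expRN lef_pV2 ?posrE ?expR_gt0//.
by apply: le_trans (expR_ge1Dx x); lra.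
Qed.

Lemma ffact_leq_exp n k : (n ^_ k <= n ^ k)%N.
Proof. by elim: k => // k IH; rewrite ffactnSr expnSr leq_mul// leq_subr. Qed.

(** Since [k ^ k / k!] is one term of the exponential series, it is at most [expR k], hence at most
    [3 ^ k]. *)
Lemma bin_le_exp n k : (0 < k)%N -> 'C(n, k)%:R <= (3 * n%:R / k%:R) ^+ k :> R.
Proof.
move=> k0; have kR : 0 < k%:R :> R by rewrite ltr0n.
have fR : 0 < k`!%:R :> R by rewrite ltr0n fact_gt0.
rewrite -(ler_pM2r fR) -[leLHS]natrM bin_ffact.
apply: le_trans (_ : n%:R ^+ k <= _); first by rewrite -natrX ler_nat ffact_leq_exp.
have h : k%:R ^+ k / k`!%:R <= 3 ^+ k :> R.
  apply: le_trans (_ : expR k%:R <= _).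
    case: k k0 {kR fR} => // k _.
    by apply: le_trans (expR_ge1Dxn k (ler0n _ _)); rewrite lerDr.
  by rewrite -[k%:R]mul1r expRM_natr lerXn2r ?nnegrE ?expR_ge0// expR1_le3.
move: h; rewrite ler_pdivrMr// => h.
rewrite expr_div_n exprMn mulrAC ler_pdivlMr ?exprn_gt0// mulrC.
by rewrite [X in _ <= X]mulrAC ler_wpM2r ?exprn_ge0.
Qed.

Lemma bin2_natr n : 'C(n, 2)%:R * 2 = n%:R * (n%:R - 1) :> R.
Proof.
case: n => [|n]; first by rewrite bin0n !mul0r.
have := mul_bin_diag n.+1 1; rewrite /= bin1 => h.
by rewrite -natrM mulnC -h natrM -natr1 addrK.
Qed.

End NumericBounds.
(* Times corresponding to edge densities 9/10 ln n / n and 2 ln n / n: with high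
   probability there still are isolated vertices at the former, while the
   minimum degree is at least 2 at the latter. *)
Definition lower_time (R : realType) (n : nat) : nat :=
  Num.truncn (9 / 20 * n%:R * ln (n%:R : R)).

Definition upper_time (R : realType) (n : nat) : nat :=
  Num.truncn (n%:R * ln (n%:R : R)).

(** * Densities at the two times; extreme degrees at the later one *)

Section DegreeEvents.
Variables (R : realType) (n : nat).
Local Notation L := (@ln R n%:R).
Local Notation K := (complete n).
Local Notation tuples := ('C(n, 2).-tuple {set 'I_n}).
Local Notation N := ('C(n, 2)).
Local Notation m1 := (lower_time R n).
Local Notation m2 := (upper_time R n).
Local Notation p1 := (m1%:R / N%:R : R).
Local Notation p2 := (m2%:R / N%:R : R).
Hypotheses (hL : 1000 <= L) (hn : 1000 * L <= n%:R).

Lemma n_ge1000 : 1000 <= n%:R :> R.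
Proof. by apply: le_trans hn; have := hL; lra. Qed.

Lemma log_gt0 : 0 < L.
Proof. by have := hL; lra. Qed.

Lemma n_gt5 : (5 < n)%N.
Proof. by rewrite -(ltr_nat R); have := n_ge1000; lra. Qed.

Lemma n_expR : n%:R = expR L.
Proof. by rewrite lnK// posrE; have := n_ge1000; lra. Qed.

Lemma binn2_natr : N%:R = n%:R * (n%:R - 1) / 2 :> R.
Proof. by have := bin2_natr R n; lra. Qed.

Lemma upper_time_le : m2%:R <= n%:R * L.
Proof. by rewrite truncn_le mulr_ge0// ltW ?log_gt0. Qed.

Lemma upper_time_gt : n%:R * L - 1 <= m2%:R.
Proof. by rewrite lerBlDr natr1; exact/ltW/truncnS_gt. Qed.

Lemma lower_time_le : m1%:R <= 9 / 20 * n%:R * L.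
Proof.
rewrite truncn_le; have := log_gt0 => h; have h' : 0 <= n%:R :> R by [].
apply: mulr_ge0; last exact: ltW.
by apply: mulr_ge0 => //; lra.
Qed.

Lemma lower_time_gt : 9 / 20 * n%:R * L - 1 <= m1%:R.
Proof. by rewrite lerBlDr natr1; exact/ltW/truncnS_gt. Qed.

Lemma upper_time_leN : (m2 <= N)%N.
Proof.
rewrite -(ler_nat R) binn2_natr; apply: le_trans upper_time_le _.
by rewrite -mulrA ler_wpM2l//; have := hL; have := hn; lra.
Qed.

Lemma lower_le_upper_time : (m1 <= m2)%N.
Proof.
apply: le_truncn; rewrite -mulrA ler_piMl//; last by lra.
by rewrite mulr_ge0//; have := hL; lra.
Qed.

Lemma lower_time_leN : (m1 <= N)%N.
Proof. exact: leq_trans lower_le_upper_time upper_time_leN. Qed.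

(** Both sides are the average degree of a graph with [m] edges. *)
Lemma time_ratio m : m%:R / N%:R * (n%:R - 1) = 2 * m%:R / n%:R :> R.
Proof. by rewrite binn2_natr; have := n_ge1000 => h; field; apply/andP; split; lra. Qed.

Lemma upper_density_le : p2 * (n%:R - 1) <= 2 * L.
Proof.
rewrite time_ratio ler_pdivrMr; last by have := n_ge1000; lra.
by have := upper_time_le; lra.
Qed.

Lemma upper_density_ge : 2 * L - 1 <= p2 * (n%:R - 1).
Proof.
rewrite time_ratio ler_pdivlMr; last by have := n_ge1000; lra.
by have := upper_time_gt; have := n_ge1000; lra.
Qed.

Lemma lower_density_le : p1 * (n%:R - 1) <= 9 / 10 * L.
Proof.
rewrite time_ratio ler_pdivrMr; last by have := n_ge1000; lra.
by have := lower_time_le; lra.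
Qed.

Lemma lower_density_ge : 9 / 10 * L <= p1 * n%:R.
Proof.
have h := n_ge1000.
suff : 9 / 10 * L * (n%:R - 1) <= p1 * n%:R * (n%:R - 1) by rewrite ler_pM2r//; lra.
rewrite [leRHS]mulrAC time_ratio divfK; last by rewrite gt_eqF; lra.
by have := lower_time_gt; have := hL; lra.
Qed.

Lemma lower_density_small : p1 * 5 <= 1.
Proof.
have hL0 := log_gt0; have p0 : 0 <= p1 by rewrite divr_ge0.
have h : p1 * 900 * L <= p1 * (n%:R - 1).
  by rewrite -mulrA ler_wpM2l//; have := hL; have := hn; lra.
suff : p1 * 5 * L <= 1 * L by rewrite ler_pM2r.
by have := lower_density_le; move: h; move: (p1) => p; lra.
Qed.

(** Side condition of the exponential moment bound: two stars have at most [2 * n] edges and a short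
    path at most [4]. *)
Lemma card_small_N k : (k <= 2 * n + 4)%N -> (2 * k <= N)%N.
Proof.
rewrite -!(ler_nat R) natrD !natrM binn2_natr => h.
have h' := n_ge1000; have : 1000 * (n%:R - 1) <= n%:R * (n%:R - 1) :> R.
  by rewrite ler_wpM2r//; lra.
by lra.
Qed.

(** With [d = 1] and [z = 1/20] the tail bound has a factor [20] and an exponent
    [19/20 * (2 * L - 1)]. A vertex thus has degree at most [1] with probability at most
    [60 * n ^ (-1.9)], which survives the sum over [n] vertices. *)
Lemma prob_mindeg_upper :
  process_prob R (fun s : tuples => ~~ (2 <= mindeg (process s m2))%N) <= 100 / L.
Proof.
have h' := n_ge1000.
apply: le_trans (_ : \sum_(v : 'I_n)
  process_prob R (fun s : tuples => (set0 : graph n) \subset process s m2 /\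
     (#|fan v [set v] :&: process s m2| <= 1)%N) <= _).
  apply: le_trans (process_prob_union _ _ _); apply: process_prob_mono => s hs.
  have n2 : (2 <= n)%N by apply: leq_trans n_gt5.
  move=> /(mindegP _ n2) /existsNP[v hv]; exists v => //; split; first exact: sub0set.
  by rewrite -degE ?process_sub// leqNgt; apply/negP.
apply: le_trans (_ : \sum_(v : 'I_n) 60 * expR (- (19 / 10 * L)) <= _).
  apply: ler_sum => v _.
  have cF := card_fan (set11 v); rewrite cards1 in cF.
  apply: le_trans (@process_prob_hit_card_le R n m2 m2 set0 (fan v [set v]) (1 / 20) 1
    _ upper_time_leN upper_time_leN (sub0set _) (fan_sub_complete (set11 v)) _ _) _.
  - by apply/andP; split; lra.
  - by rewrite -setI_eq0 set0I.
  - by rewrite cards0 cF card_small_N// add0n; lia.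
  rewrite cards0 expr0 mulr1 cF expr1 natrB; last by apply: leq_trans n_gt5.
  have -> : (1 / 20 : R)^-1 = 20 by field.
  apply: le_trans (_ : 20 * (expR 1 * expR (- (19 / 10 * L))) <= _); last first.
    rewrite mulrA ler_wpM2r ?expR_ge0//; have := expR1_le3 R; lra.
  rewrite ler_wpM2l// -expRD ler_expR.
  by have := upper_density_ge; move: (p2) => p; lra.
rewrite sumr_const card_ord -[leLHS]mulr_natr -[leLHS]mulrA [X in _ * (_ * X)]n_expR -expRD.
apply: le_trans (_ : 60 * expR (- (9 / 10 * L)) <= _).
  by rewrite ler_wpM2l// ler_expR; lra.
have L0 : 0 < L by have := hL; lra.
have h9 : 0 < 9 / 10 * L by lra.
apply: le_trans (ler_wpM2l _ (expRN_le_inv h9)) _ => //.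
rewrite invfM mulrA ler_wpM2r ?invr_ge0 ?ltW//; lra.
Qed.

(** With [t] just above [10 * L], the probability of [t] edges at a vertex is at most [(6 * L / t) ^
    t <= (6/10) ^ t <= expR (- (4/10 * t)) <= n ^ (-4)]. *)
Lemma prob_maxdeg_upper :
  process_prob R (fun s : tuples => ~ ((maxdeg (process s m2))%:R <= 10 * L)) <= 1 / L.
Proof.
have h' := n_ge1000; have L0 : 0 < L by have := hL; lra.
set t := (Num.truncn (10 * L)).+1.
have tL : 10 * L <= t%:R by apply/ltW/truncnS_gt.
have t0 : 0 < t%:R :> R by rewrite ltr0n.
apply: le_trans (_ : \sum_(v : 'I_n)
  process_prob R (fun s : tuples => (t <= #|fan v [set v] :&: process s m2|)%N) <= _).
  apply: le_trans (process_prob_union _ _ _); apply: process_prob_mono => s hs hd.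
  apply: contrapT => hv; apply: hd.
  apply: le_trans (_ : (Num.truncn (10 * L))%:R <= _); last by rewrite truncn_le; lra.
  rewrite ler_nat; apply/maxdeg_leP => v; rewrite -ltnS ltnNge; apply/negP => hv'.
  by apply: hv; exists v => //; rewrite -degE ?process_sub.
apply: le_trans (_ : \sum_(v : 'I_n) expR (- (4 * L)) <= _).
  apply: ler_sum => v _.
  have cF := card_fan (set11 v); rewrite cards1 in cF.
  apply: le_trans (@process_prob_card_ge R n m2 (fan v [set v]) t upper_time_leN
    (fan_sub_complete (set11 v))) _.
  have t0' : (0 < t)%N by [].
  move: t tL t0 t0' => t tL t0 t0'.
  have hp : 0 <= p2 ^+ t by rewrite exprn_ge0 ?divr_ge0.
  apply: le_trans (ler_wpM2r hp (bin_le_exp R _ t0')) _.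
  rewrite -exprMn cF natrB; last by apply: leq_trans n_gt5.
  have -> : 3 * (n%:R - 1) / t%:R * p2 = 3 * (p2 * (n%:R - 1)) / t%:R.
    by move: (p2) => p; field; lra.
  apply: le_trans (_ : expR (- (4 / 10)) ^+ t <= _).
    rewrite lerXn2r ?nnegrE ?expR_ge0//.
      by rewrite divr_ge0 ?ler0n// !mulr_ge0 ?divr_ge0 ?ler0n//; lra.
    apply: le_trans (expR_ge1Dx _); rewrite ler_pdivrMr//; have := upper_density_le; lra.
  by rewrite -expRM_natr ler_expR; lra.
rewrite sumr_const card_ord -[leLHS]mulr_natr [X in _ * X]n_expR -expRD.
apply: le_trans (_ : expR (- L) <= _); first by rewrite ler_expR; lra.
by rewrite mul1r expRN_le_inv.
Qed.

End DegreeEvents.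

(** * Small vertices at the earlier time and short paths between them *)

Section SmallEvents.
Variables (R : realType) (n : nat) (delta0 : R).
Local Notation L := (@ln R n%:R).
Local Notation K := (complete n).
Local Notation tuples := ('C(n, 2).-tuple {set 'I_n}).
Local Notation N := ('C(n, 2)).
Local Notation m1 := (lower_time R n).
Local Notation m2 := (upper_time R n).
Local Notation p1 := (m1%:R / N%:R : R).
Local Notation p2 := (m2%:R / N%:R : R).
Local Notation d := (Num.truncn (delta0 * L)).
Hypotheses (hL : 1000 <= L) (hn : 1000 * L <= n%:R).
Hypothesis hdelta : 0 < delta0 <= 1 / 1000.
Local Notation q := (expR (- (8 / 10 * L))).
Implicit Types (x y v : 'I_n) (V : {set 'I_n}) (P : graph n).

Lemma SMALL_deg (G : graph n) v : v \in SMALL delta0 G -> (deg G v <= d)%N.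
Proof.
rewrite inE /d0 truncEfloor; case: Num.floor => k; last by [].
by rewrite ltz_nat => /ltnW.
Qed.

(** The estimate [n ^ (-0.8)] for a small degree. As [d <= L / 1000], the factor [20 ^ d] is at most
    [expR (L / 50)]; the exponent [0.95 * 0.9 * L] loses only this and, since [5 * p1 <= 1], a
    constant for the at most [5] omitted vertices. *)
Lemma small_tail f : n%:R - 5 <= f%:R :> R ->
  (1 / 20) ^- d * expR (- ((1 - 1 / 20) * p1 * f%:R)) <= q.
Proof.
move=> hf; have hn' := n_ge1000 hL hn; have hL0 := log_gt0 hL.
have dL : d%:R <= L / 1000.
  apply: le_trans (_ : delta0 * L <= _).
    by rewrite truncn_le mulr_ge0// ltW//; case/andP: hdelta.
  by rewrite mulrC ler_pM2l//; case/andP: hdelta => _; lra.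
have h20 : (1 / 20) ^- d <= expR (L / 50).
  rewrite -exprVn; apply: le_trans (_ : expR (20 * d%:R) <= _).
    rewrite expRM_natr lerXn2r ?nnegrE ?expR_ge0 ?invr_ge0 ?divr_ge0//.
    apply: le_trans (expR_ge1Dx _); have -> : (1 / 20 : R)^-1 = 20 by field.
    by lra.
  by rewrite ler_expR; lra.
apply: le_trans (ler_wpM2r (expR_ge0 _) h20) _; rewrite -expRD ler_expR.
have p10 : 0 <= p1 by rewrite divr_ge0.
have : p1 * (n%:R - 5) <= p1 * f%:R by rewrite ler_wpM2l.
have := lower_density_ge hL hn.
have := lower_density_small hL hn; clear dL h20.
by move: p10; move: (p1) => p p0 h1 h2 h3; have := hL; lra.
Qed.

Lemma prob_path_one x V P : x \in V -> (#|V| <= 5)%N -> (#|P| <= 4)%N ->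
  P \subset K -> [disjoint P & fan x V] ->
  process_prob R (fun s : tuples => P \subset process s m2 /\ (deg (process s m1) x <= d)%N)
    <= (2 * p2) ^+ #|P| * q.
Proof.
move=> xV V5 P4 PK dP; have n5 := n_gt5 hL hn.
have cF := card_fan xV.
apply: le_trans (_ : process_prob R (fun s : tuples => P \subset process s m2 /\
   (#|fan x V :&: process s m1| <= d)%N) <= _).
  apply: process_prob_mono => s _ [-> h]; split=> //.
  exact: leq_trans (card_fan_le_deg _ _ _) h.
apply: le_trans (@process_prob_hit_card_le R n m1 m2 P (fan x V) (1 / 20) d
    _ (lower_time_leN hL hn) (upper_time_leN hL hn) PK (fan_sub_complete xV) dP _) _.
- by apply/andP; split; lra.
- by apply: (card_small_N hL hn); rewrite cF; clear -P4 n5; lia.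
rewrite mulrAC [leRHS]mulrC -[2 * _ / _]mulrA ler_wpM2r ?exprn_ge0 ?mulr_ge0//.
apply: small_tail; rewrite cF natrB ?lerB// ?ler_nat//.
by apply: leq_trans V5 (ltnW n5).
Qed.

(** The stars at [x] and [y] outside [V] are disjoint, so two small degrees leave at most [d + d]
    edges in a union of twice the size, and the estimate for one vertex is squared. *)
Lemma prob_path_two x y V P : x != y -> x \in V -> y \in V -> (#|V| <= 5)%N ->
  (#|P| <= 4)%N -> P \subset K -> [disjoint P & fan x V] -> [disjoint P & fan y V] ->
  process_prob R (fun s : tuples => [/\ P \subset process s m2,
     (deg (process s m1) x <= d)%N & (deg (process s m1) y <= d)%N])
    <= (2 * p2) ^+ #|P| * q ^+ 2.
Proof.
move=> xy xV yV V5 P4 PK dPx dPy; have n5 := n_gt5 hL hn.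
have cF : #|fan x V :|: fan y V| = ((n - #|V|) + (n - #|V|))%N.
  by rewrite -{1}(card_fan xV) -(card_fan yV); apply/eqP;
    rewrite (leq_card_setU _ _) disjoint_fan.
apply: le_trans (_ : process_prob R (fun s : tuples => P \subset process s m2 /\
   (#|(fan x V :|: fan y V) :&: process s m1| <= d + d)%N) <= _).
  apply: process_prob_mono => s _ [-> hx hy]; split=> //; rewrite setIUl.
  apply: leq_trans (leq_card_setU _ _) _; apply: leq_add.
    exact: leq_trans (card_fan_le_deg _ _ _) hx.
  exact: leq_trans (card_fan_le_deg _ _ _) hy.
apply: le_trans (@process_prob_hit_card_le R n m1 m2 P (fan x V :|: fan y V) (1 / 20)
    (d + d) _ (lower_time_leN hL hn) (upper_time_leN hL hn) PK _ _ _) _.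
- by apply/andP; split; lra.
- by rewrite subUset !fan_sub_complete.
- by rewrite disjoint_sym -setI_eq0 setIUl setU_eq0 !setI_eq0 ![[disjoint fan _ _ & _]]disjoint_sym dPx.
- by apply: (card_small_N hL hn); rewrite cF; clear -P4 n5; lia.
rewrite mulrAC [leRHS]mulrC -[2 * _ / _]mulrA ler_wpM2r ?exprn_ge0 ?mulr_ge0//.
rewrite cF natrD mulrDr opprD expRD exprD invfM mulrACA expr2.
have h : (1 / 20) ^- d * expR (- ((1 - 1 / 20) * p1 * (n - #|V|)%:R)) <= q.
  apply: small_tail; rewrite natrB ?lerB// ?ler_nat//.
  by apply: leq_trans V5 (ltnW n5).
by rewrite ler_pM// mulr_ge0 ?expR_ge0// invr_ge0 exprn_ge0//; lra.
Qed.

(** Markov's inequality: the mean is at most [n * q = n ^ 0.2], against the threshold [n ^ 0.3]. *)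
Lemma prob_card_SMALL :
  process_prob R (fun s : tuples => ~ P2 delta0 (process s m1)) <= 10 / L.
Proof.
have hn' := n_ge1000 hL hn; have hL0 := log_gt0 hL.
have n03 : n%:R `^ (3 / 10) = expR (3 / 10 * L).
  by rewrite /powR gt_eqF//; lra.
apply: le_trans (_ : process_expect (fun s : tuples =>
    expR (- (3 / 10 * L)) * \sum_(v : 'I_n) `[< v \in SMALL delta0 (process s m1) >]%:R) <= _).
  apply: process_prob_le_expect => s _; first by rewrite mulr_ge0 ?expR_ge0 ?sumr_ge0.
  rewrite /P2 n03 => /negP; rewrite -ltNge => /ltW.
  rewrite -sum1_card natr_sum big_mkcond /= expRN ler_pdivlMl ?expR_gt0// mulr1.
  move/le_trans; apply; apply: ler_sum => v _.
  by rewrite asboolb; case: ifP.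
rewrite process_expectZ process_expect_sum.
apply: le_trans (_ : expR (- (3 / 10 * L)) * \sum_(v : 'I_n) q <= _).
  rewrite ler_wpM2l ?expR_ge0//; apply: ler_sum => v _; rewrite -process_probE.
  apply: le_trans (@process_prob_mono R n _ (fun s : tuples =>
    (set0 : graph n) \subset process s m2 /\ (deg (process s m1) v <= d)%N) _) _.
    by move=> s _ /SMALL_deg h; split; rewrite ?sub0set.
  apply: le_trans (@prob_path_one v [set v] set0 _ _ _ _ _) _.
  - by rewrite inE.
  - by rewrite cards1.
  - by rewrite cards0.
  - by rewrite sub0set.
  - by rewrite -setI_eq0 set0I.
  by rewrite cards0 expr0 mul1r.
rewrite sumr_const card_ord -[q *+ n]mulr_natr [X in _ * (_ * X)](n_expR hL hn) -!expRD.
apply: le_trans (_ : expR (- (1 / 10 * L)) <= _); first by rewrite ler_expR; lra.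
have h1 : 0 < 1 / 10 * L by lra.
apply: le_trans (expRN_le_inv h1) _.
by have -> : (1 / 10 * L)^-1 = 10 / L by field; lra.
Qed.

(** The half of [is_path] that does not mention the graph, so that it can be used before an ordering
    is fixed. *)
Definition simple_trail x (p : seq 'I_n) : bool :=
  uniq (x :: p) || [&& (2 < size p)%N, uniq p & last x p == x].

Lemma simple_trail_edges_uniq x p : simple_trail x p -> uniq (path_edges x p).
Proof.
by case/orP => [/path_edges_uniq//|/and3P[s2 up /eqP lx]]; exact: cycle_edges_uniq.
Qed.

Definition small_path x p (s : tuples) : Prop :=
  [/\ is_path (process s m2) x p, x \in SMALL delta0 (process s m1) &
      last x p \in SMALL delta0 (process s m1)].

Lemma prob_small_path x p : (0 < size p <= 4)%N ->
  process_prob R (small_path x p) <=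
  (2 * p2) ^+ size p * (if last x p == x then q else q ^+ 2).
Proof.
move=> /andP[p0 p4].
have rhs0 : 0 <= (2 * p2) ^+ size p * (if last x p == x then q else q ^+ 2).
  by rewrite mulr_ge0 ?exprn_ge0 ?mulr_ge0 ?divr_ge0//; case: ifP; rewrite ?exprn_ge0 ?expR_ge0.
(* If no ordering realises the path, the probability is [0]; otherwise a realising ordering [s0]
   shows that all edges of the path belong to [K]. *)
have [[tr [s0 hs0 pth0]]|nth] := pselect (simple_trail x p /\
    exists2 s : tuples, s \in edge_orderings n & is_path (process s m2) x p); last first.
  apply: le_trans rhs0; rewrite process_probE -[leRHS](process_expect_cst n 0).
  apply: process_expect_le => s hs; case: asboolP => // -[pth _ _]; case: nth; split.
    by case/andP: pth.
  by exists s.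
have up := simple_trail_edges_uniq tr.
set V := [set v in x :: p]; set P : graph n := [set e in path_edges x p].
have cP : #|P| = size p by rewrite cardsE; move/card_uniqP: up ->; rewrite size_pairmap.
have V5 : (#|V| <= 5)%N by rewrite cardsE (leq_trans (card_size _)).
have xV : x \in V by rewrite !inE eqxx.
have lV : last x p \in V by rewrite inE mem_last.
have PG s : is_path (process s m2) x p -> P \subset process s m2.
  by case/andP => /path_edges_in h _; apply/fintype.subsetP => e; rewrite inE => /h.
have PK : P \subset K by apply: subset_trans (PG s0 pth0) (process_sub _ _).
have dP y : [disjoint P & fan y V].
  apply/pred0P => e /=; apply/negbTE/negP => /andP[]; rewrite inE => /path_edges_sub h.
  case/imsetP => v; rewrite !inE => vV E; have := h v.
  by rewrite E !inE eqxx orbT (negbTE vV) => /(_ isT).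
have P4 : (#|P| <= 4)%N by rewrite cP.
rewrite -cP; case: ifPn => [_|lx].
  apply: le_trans (prob_path_one xV V5 P4 PK (dP x)); apply: process_prob_mono => s _.
  by move=> [/PG h /SMALL_deg hx _]; split.
rewrite eq_sym in lx; apply: le_trans (prob_path_two lx xV lV V5 P4 PK (dP _) (dP _)).
by apply: process_prob_mono => s _ [/PG h /SMALL_deg hx /SMALL_deg hy]; split.
Qed.

(** The [n ^ k.+1] choices of [p] combine with the edge factors into
    [(2 * p2 * n) ^ k.+1 <= (5 * L) ^ 4]. For each [p] a single start [x] closes the path, so the
    sum over [x] is at most [q + n * q ^ 2 = n ^ (-0.8) + n ^ (-0.6)]. *)
Lemma prob_small_paths_tuple k : (k < 4)%N ->
  process_prob R (fun s : tuples =>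
     exists2 xp : 'I_n * k.+1.-tuple 'I_n, true & small_path xp.1 xp.2 s)
  <= (5 * L) ^+ 4 * (2 * expR (- (6 / 10 * L))).
Proof.
move=> k4; have hn' := n_ge1000 hL hn; have hL0 := log_gt0 hL.
apply: le_trans (process_prob_union _ _ _) _.
set c := (2 * p2) ^+ k.+1; have c0 : 0 <= c by rewrite exprn_ge0 ?mulr_ge0 ?divr_ge0.
have q0 : 0 <= q by rewrite expR_ge0.
apply: le_trans (_ : \sum_(xp : 'I_n * k.+1.-tuple 'I_n)
    c * (if last xp.1 xp.2 == xp.1 then q else q ^+ 2) <= _).
  apply: ler_sum => -[x p] _ /=; have := @prob_small_path x p.
  by rewrite size_tuple; apply.
rewrite -mulr_sumr -(pair_bigA _ (fun x (p : k.+1.-tuple 'I_n) =>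
   if last x p == x then q else q ^+ 2)) /= exchange_big /=.
apply: le_trans (_ : c * \sum_(p : k.+1.-tuple 'I_n) (q + n%:R * q ^+ 2) <= _).
  rewrite ler_wpM2l//; apply: ler_sum => p _.
  have [y hy] : exists y, forall x, last x p = y.
    by case/tupleP: p => y t; exists (last y t).
  rewrite (bigD1 y)//= hy eqxx lerD2l.
  apply: le_trans (_ : \sum_(i < n) q ^+ 2 <= _); last first.
    by rewrite sumr_const card_ord -[_ *+ n]mulr_natl.
  rewrite [leLHS]big_mkcond /=; apply: ler_sum => x _; rewrite hy eq_sym.
  by case: eqVneq => _ //=; rewrite exprn_ge0.
rewrite sumr_const card_tuple card_ord -[_ *+ (n ^ _)]mulr_natr natrX [c * _]mulrCA
  [leLHS]mulrC /c -exprMn.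
apply: ler_pM; rewrite ?exprn_ge0 ?addr_ge0 ?mulr_ge0 ?exprn_ge0 ?divr_ge0//.
  apply: le_trans (_ : (5 * L) ^+ k.+1 <= _); last first.
    by rewrite ler_weXn2l//; have := hL; lra.
  have p2n : p2 * n%:R <= 5 / 2 * L.
    have p20 : 0 <= p2 by rewrite divr_ge0.
    have := upper_density_le hL hn; have : p2 * 1000 <= p2 * n%:R by rewrite ler_wpM2l.
    move: (p2) p20 => p p0; lra.
  rewrite lerXn2r ?nnegrE ?mulr_ge0 ?divr_ge0// ?(ltW hL0)//.
  by move: (p2) p2n => p; lra.
have -> : n%:R * q ^+ 2 = expR (L - 16 / 10 * L).
  transitivity (expR L * q ^+ 2); first by congr (_ * _); exact: (n_expR hL hn).
  by rewrite -expRM_natr -expRD; congr expR; lra.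
by rewrite [leRHS]mulr_natl [leRHS]mulr2n lerD// ler_expR; lra.
Qed.

Definition small_path_ends (s : tuples) : Prop :=
  exists (x : 'I_n) (p : seq 'I_n), (0 < size p <= 4)%N /\ small_path x p s.

Lemma prob_small_path_ends :
  process_prob R small_path_ends <= (8 * 5 ^+ 4 * 10 ^+ 5) / L.
Proof.
have hn' := n_ge1000 hL hn; have hL0 := log_gt0 hL.
apply: le_trans (_ : process_prob R (fun s : tuples => exists2 k : 'I_4, true &
   exists2 xp : 'I_n * k.+1.-tuple 'I_n, true & small_path xp.1 xp.2 s) <= _).
  apply: process_prob_mono => s _ [x [p [/andP[p0 p4] h]]].
  have p4' : ((size p).-1 < 4)%N by rewrite prednK.
  exists (Ordinal p4') => //=.
  have sp : size p == (size p).-1.+1 by rewrite prednK.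
  by exists (x, Tuple sp).
apply: le_trans (process_prob_union _ _ _) _.
apply: le_trans (ler_sum _ (fun (k : 'I_4) _ => prob_small_paths_tuple (ltn_ord k))) _.
rewrite sumr_const card_ord.
(* Its fifth power absorbs the [L ^ 4] of the edges and the [L] of the denominator, at the price of
   [expR (L / 2)], still below [expR (6 / 10 * L)]. *)
have hLe : L <= 10 * expR (L / 10).
  by have := expR_ge1Dx (L / 10); lra.
have hL5 : L ^+ 5 <= 10 ^+ 5 * expR (L / 2).
  have -> : L / 2 = L / 10 * 5 by field.
  by rewrite expRM_natr -exprMn lerXn2r// nnegrE ?mulr_ge0 ?expR_ge0// ltW.
have e6 : expR (- (6 / 10 * L)) <= expR (- (L / 2)) by rewrite ler_expR; lra.
rewrite ler_pdivlMr// -[_ *+ 4]mulr_natr exprMn.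
have -> : 5 ^+ 4 * L ^+ 4 * (2 * expR (- (6 / 10 * L))) * 4 * L =
   8 * 5 ^+ 4 * (L ^+ 5 * expR (- (6 / 10 * L))).
  by move: (expR _) => e; ring.
rewrite ler_wpM2l ?mulr_ge0 ?exprn_ge0//.
apply: le_trans (ler_pM _ _ hL5 e6) _.
- by rewrite exprn_ge0// ltW.
- by rewrite expR_ge0.
by rewrite -mulrA -expRD subrr expR0 mulr1.
Qed.

End SmallEvents.

(** * Existence of isolated vertices at the earlier time *)

Section Isolated.
Variables (R : realType) (n : nat).
Local Notation L := (@ln R n%:R).
Local Notation K := (complete n).
Local Notation tuples := ('C(n, 2).-tuple {set 'I_n}).
Local Notation N := ('C(n, 2)).
Local Notation m1 := (lower_time R n).
Local Notation ratio := (avoid_ratio R).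

(** Negative correlation: [(M - m - i) / (M - i)] decreases in [i], so the last [b] factors are at
    most the first [b]. *)
Lemma avoid_ratioD M m a b : (a + b <= M)%N ->
  ratio M m (a + b) <= ratio M m a * ratio M m b.
Proof.
move=> abM; rewrite /avoid_ratio big_split_ord /= ler_wpM2l//; first exact: avoid_ratio_ge0.
apply: ler_prod => i _; rewrite divr_ge0//= ler_pdivrMr; last first.
  by rewrite ltr0n subn_gt0; apply: leq_trans abM; rewrite ltn_add2l.
rewrite mulrAC ler_pdivlMr; last first.
  by rewrite ltr0n subn_gt0; apply: leq_trans abM; rewrite (leq_trans (ltn_ord i))// leq_addl.
have ib := ltn_ord i; rewrite -!natrM ler_nat; move: (nat_of_ord i) ib => {}i ib.
have h : (a + i <= M)%N by clear -abM ib; lia.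
have [mi|mi] := leqP (M - m) (a + i); first by rewrite (eqP mi) mul0n.
by clear -h mi; nia.
Qed.

(** Each factor is the inverse of [1 + m / (M - m - i)], which is at most
    [expR (m / (M - m - j))]. *)
Lemma avoid_ratio_ge M m j : (m + j < M)%N ->
  expR (- (m%:R / (M - m - j)%:R * j%:R)) <= ratio M m j.
Proof.
move=> h; rewrite -mulNr expRM_natr /avoid_ratio -[X in _ ^+ X]card_ord -prodr_const.
apply: ler_prod => i _; rewrite expR_ge0 /=.
have ij := ltn_ord i; move: (nat_of_ord i) ij => {}i ij.
have a0 : (0 < M - m - i)%N by clear -h ij; lia.
have b0 : (0 < M - m - j)%N by clear -h ij; lia.
have e : ((M - i) = m + (M - m - i))%N by clear -h ij; lia.
have ab : (M - m - j <= M - m - i)%N by clear -ij; lia.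
have aR : 0 < (M - m - i)%:R :> R by rewrite ltr0n.
have cR : 0 < m%:R + (M - m - i)%:R :> R by rewrite ltr_wpDl.
rewrite e natrD expRN -[leRHS]invf_div lef_pV2 ?posrE ?expR_gt0 ?divr_gt0//.
rewrite mulrDl divff ?gt_eqF// addrC.
apply: le_trans (expR_ge1Dx _) _; rewrite ler_expR ler_wpM2l// lef_pV2 ?posrE ?ltr0n//.
by rewrite ler_nat.
Qed.

Hypotheses (hL : 1000 <= L) (hn : 1000 * L <= n%:R).

Local Notation isolated v s := (deg (process s m1) v == 0%N).

Lemma prob_isolated v :
  process_prob R (fun s : tuples => isolated v s) = ratio N m1 n.-1.
Proof.
have vv : v \in [set v] by rewrite inE.
have <- : #|fan v [set v]| = n.-1 by rewrite card_fan// cards1 subn1.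
rewrite -(process_prob_avoid R (lower_time_leN hL hn) (fan_sub_complete vv)).
rewrite !process_prob_bool; congr (_%:R / _); apply: eq_card => s; rewrite !in_set.
by case hs: (perm_eq _ _) => //=; rewrite deg0_disjoint ?process_sub// in_set.
Qed.

(** The edge joining [u] and [v] is shared and is counted at [u] only, whence the sizes [n.-1] and
    [n.-2]. *)
Lemma prob_isolated_pair u v : u != v ->
  process_prob R (fun s : tuples => isolated u s /\ isolated v s) <=
  ratio N m1 n.-1 * ratio N m1 n.-2.
Proof.
move=> uv; have n5 := n_gt5 hL hn.
have uu : u \in [set u] by rewrite inE.
have vuv : v \in [set u; v] by rewrite !inE eqxx orbT.
set S := fan u [set u] :|: fan v [set u; v].
have cS : #|S| = (n.-1 + n.-2)%N.
  have -> : #|S| = (#|fan u [set u]| + #|fan v [set u; v]|)%N.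
    apply/eqP; rewrite (leq_card_setU _ _); apply/pred0P => e /=.
    apply/negbTE/negP => /andP[/imsetP[w _ ->] /in_fan_notin].
    by move=> /(_ u); rewrite !inE eqxx => /(_ isT uv).
  by rewrite !card_fan// cards1 cards2 uv subn1 subn2.
have SK : S \subset K by rewrite subUset !fan_sub_complete.
apply: le_trans (_ : process_prob R (fun s : tuples => [disjoint S & process s m1]) <= _).
  apply: process_prob_mono => s hs [].
  rewrite !deg0_disjoint ?process_sub// -!setI_eq0 setIUl setU_eq0 => -> /=.
  move=> /eqP h; rewrite -subset0 -h; apply: setSI; apply: imsetS.
  by rewrite setCS subsetUr.
rewrite process_prob_avoid ?(lower_time_leN hL hn)// cS; apply: avoid_ratioD.
have := @card_small_N R n hL hn (n.-1 + n.-2) _; clear -n5; lia.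
Qed.

Local Notation f1 := (ratio N m1 n.-1).
Local Notation g := ((N - m1 - n.-2)%:R / (N - n.-2)%:R : R).

Lemma lower_time_room : (n%:R + m1%:R) * 20 <= N%:R :> R.
Proof.
have hn' := n_ge1000 hL hn; rewrite (binn2_natr R n); have := lower_time_le hL.
have : (1000 * L - 1) * n%:R <= (n%:R - 1) * n%:R by rewrite ler_wpM2r//; have := hn; lra.
have : 1000 * n%:R <= L * n%:R by rewrite ler_wpM2r.
by move: (m1%:R) => m; lra.
Qed.

Lemma lower_time_room_nat : (n + m1 + n + m1 < N)%N.
Proof.
rewrite -(ltr_nat R) !natrD; have := lower_time_room; have := n_ge1000 hL hn.
by have : 0 <= m1%:R :> R by []; move: (m1%:R : R) => m; lra.
Qed.

(** The exponent [m1 * (n - 1) / N] is at most [9/10 * L]; the margin up to [19/20 * L] pays for the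
    denominator [N - m1 - n.-1], which is at least [19/20 * N]. *)
Lemma isolated_mean_ge : expR (L / 20) <= n%:R * f1.
Proof.
have hn' := n_ge1000 hL hn; have n5 := n_gt5 hL hn; have room := lower_time_room_nat.
have hL0 := log_gt0 hL.
apply: le_trans (_ : expR L * expR (- (19 / 20 * L)) <= _).
  by rewrite -expRD ler_expR; lra.
rewrite -(n_expR hL hn) ler_wpM2l//.
have h : (m1 + n.-1 < N)%N by clear -room; lia.
apply: le_trans (avoid_ratio_ge h); rewrite ler_expR lerN2.
have d0 : 0 < (N - m1 - n.-1)%:R :> R by rewrite ltr0n; clear -room; lia.
rewrite mulrAC ler_pdivrMr//.
have e : N%:R - m1%:R - n%:R <= (N - m1 - n.-1)%:R :> R.
  by rewrite !lerBlDr -!natrD ler_nat; clear -room; lia.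
apply: le_trans (_ : 19 / 20 * L * (N%:R - m1%:R - n%:R) <= _); last first.
  by rewrite ler_wpM2l//; lra.
have e1 : n.-1%:R = n%:R - 1 :> R by rewrite -subn1 natrB// ltnW// (leq_trans _ n5).
have := lower_time_room; have := lower_time_le hL => h1 h2.
have h3 : m1%:R * n.-1%:R <= 9 / 10 * L * N%:R.
  have -> : 9 / 10 * L * N%:R = 9 / 20 * n%:R * L * (n%:R - 1).
    by rewrite (binn2_natr R n); move: L (n%:R : R) => l k; field.
  by rewrite e1 ler_wpM2r//; lra.
have : L * ((n%:R + m1%:R) * 20) <= L * N%:R by rewrite ler_wpM2l// ltW.
have : 0 <= L * N%:R by rewrite mulr_ge0 ?(ltW hL0).
by move: h3; move: (m1%:R : R) (N%:R : R) (_ * n.-1%:R) => m M x; lra.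
Qed.

(** Chebyshev's inequality for the number [X] of isolated vertices, with mean [mu]: the variance
    divided by [mu ^ 2] is at most [1 / mu + (1 / g - 1)]. *)
Lemma prob_no_isolated :
  process_prob R (fun s : tuples => ~ exists v : 'I_n, isolated v s) <= 30 / L.
Proof.
have hn' := n_ge1000 hL hn; have n5 := n_gt5 hL hn; have room := lower_time_room_nat.
have hL0 := log_gt0 hL.
set mu := n%:R * f1.
have mu_ge : expR (L / 20) <= mu := isolated_mean_ge.
have mu0 : 0 < mu by apply: lt_le_trans mu_ge; rewrite expR_gt0.
pose X (s : tuples) : R := \sum_(v : 'I_n) (isolated v s)%:R.
have EX : process_expect X = mu.
  rewrite process_expect_sum /mu -[X in X%:R]card_ord mulr_natl -sumr_const.
  apply: eq_bigr => v _; rewrite -(prob_isolated v) process_probE.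
  by apply: process_expect_eq => s _; rewrite asboolb.
have g0 : 0 < g by rewrite divr_gt0 ?ltr0n//; clear -room; lia.
(* The factor [g], close to [1], accounts for the shared edge: the bound for a pair becomes
   [f1 ^+ 2 / g]. *)
have f1E : f1 = ratio N m1 n.-2 * g.
  by rewrite -avoid_ratioS prednK//; clear -n5; lia.
have EX2 : process_expect (fun s => X s ^+ 2) <= mu + mu ^+ 2 / g.
  rewrite (@process_expect_eq R n _ (fun s => \sum_(uv : 'I_n * 'I_n)
     (isolated uv.1 s)%:R * (isolated uv.2 s)%:R)); last first.
    move=> s _; rewrite expr2 /X big_distrl /= -(pair_bigA _ (fun u v : 'I_n =>
      (isolated u s)%:R * (isolated v s)%:R)) /=.
    by apply: eq_bigr => u _; rewrite big_distrr.
  rewrite process_expect_sum.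
  apply: le_trans (_ : \sum_(uv : 'I_n * 'I_n) ((uv.1 == uv.2)%:R * f1 + f1 ^+ 2 / g) <= _).
    apply: ler_sum => -[u v] _ /=.
    have f1g : 0 <= f1 ^+ 2 / g by rewrite divr_ge0 ?exprn_ge0 ?avoid_ratio_ge0// ltW.
    have [<-|uv] := eqVneq u v.
      apply: le_trans (_ : f1 <= _); last by rewrite mul1r lerDl.
      rewrite -(prob_isolated u) process_probE; apply: process_expect_le => s _.
      by rewrite asboolb; case: (isolated u s); rewrite ?mulr0 ?mulr1.
    rewrite mul0r add0r; apply: le_trans (_ : f1 * ratio N m1 n.-2 <= _); last first.
      by rewrite expr2 -[leRHS]mulrA ler_wpM2l ?avoid_ratio_ge0// ler_pdivlMr// -f1E.
    apply: le_trans (prob_isolated_pair uv); rewrite process_probE.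
    apply: process_expect_le => s _; rewrite -natrM mulnb ler_nat.
    by case: asboolP; case: (isolated u s); case: (isolated v s) => //= h; case: h.
  rewrite big_split /= lerD//.
    rewrite -mulr_suml ler_wpM2r ?avoid_ratio_ge0//.
    rewrite -(pair_bigA _ (fun u v : 'I_n => (u == v)%:R : R)) /=.
    rewrite (eq_bigr (fun=> 1)); first by rewrite sumr_const card_ord.
    by move=> u _; rewrite (bigD1 u)//= eqxx big1 ?addr0// => v; rewrite eq_sym => /negbTE ->.
  rewrite sumr_const card_prod card_ord /mu exprMn -[_ *+ (n * n)]mulr_natl natrM -expr2.
  by rewrite mulrA.
apply: le_trans (_ : process_expect (fun s => (mu ^+ 2)^-1 * (X s - mu) ^+ 2) <= _).
  apply: process_prob_le_expect => s _.
    by rewrite mulr_ge0 ?sqr_ge0// invr_ge0 sqr_ge0.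
  move=> h; have -> : X s = 0.
    by rewrite /X big1// => v _; case: eqP => // hv; case: h; exists v; apply/eqP.
  by rewrite sub0r sqrrN mulVf// expf_neq0// gt_eqF.
rewrite process_expectZ.
have -> : process_expect (fun s => (X s - mu) ^+ 2) =
    process_expect (fun s => X s ^+ 2) - mu ^+ 2.
  rewrite (@process_expect_eq R n _ (fun s => X s ^+ 2 + (- (2 * mu) * X s + mu ^+ 2))).
    by rewrite !process_expectD process_expectZ EX process_expect_cst; ring.
  by move=> s _; ring.
apply: le_trans (_ : mu^-1 + (g^-1 - 1) <= _).
  rewrite ler_pdivrMl ?exprn_gt0//; apply: le_trans (lerB EX2 (lexx _)) _.
  rewrite le_eqVlt; apply/orP; left; apply/eqP; move: (g) g0 => g' g0'.
  by field; apply/andP; split; rewrite gt_eqF.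
have hmu : mu^-1 <= 20 / L.
  apply: le_trans (_ : expR (- (L / 20)) <= _).
    by rewrite expRN lef_pV2 ?posrE ?expR_gt0.
  have h20 : 0 < L / 20 by lra.
  by apply: le_trans (expRN_le_inv h20) _; rewrite invf_div.
have hg : g^-1 - 1 <= 10 / L.
  have e1 : (N - n.-2)%:R = (N - m1 - n.-2)%:R + m1%:R :> R.
    by rewrite -natrD; congr _%:R; clear -room; lia.
  have dd0 : 0 < (N - m1 - n.-2)%:R :> R by rewrite ltr0n; clear -room; lia.
  rewrite invf_div e1 mulrDl divff ?gt_eqF// addrAC subrr add0r.
  rewrite ler_pdivrMr// mulrAC ler_pdivlMr//.
  have e2 : N%:R - m1%:R - n%:R <= (N - m1 - n.-2)%:R :> R.
    by rewrite !lerBlDr -!natrD ler_nat; clear -room; lia.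
  apply: le_trans (_ : 10 * (N%:R - m1%:R - n%:R) <= _); last by rewrite ler_wpM2l.
  (* Since [g^-1 - 1 = m1 / (N - m1 - n.-2)] is of order [L / n], this bounds it by a constant over
     [L]. *)
  have hLn : L ^+ 2 / 2 <= n%:R.
    rewrite [leRHS](n_expR hL hn); have := @expR_ge1Dxn R L 1 (ltW hL0).
    have -> : 2`!%:R = 2 :> R by [].
    by lra.
  have := lower_time_room; have := lower_time_le hL => h1 h2.
  have h3 : m1%:R * L <= 9 / 10 * n%:R * n%:R.
    apply: le_trans (ler_wpM2r (ltW hL0) h1) _.
    have : n%:R * (L ^+ 2 / 2) <= n%:R * n%:R by rewrite ler_wpM2l.
    by lra.
  have h4 : 9 / 10 * n%:R * n%:R <= 2 * N%:R :> R.
    rewrite (binn2_natr R n); have : 1000 * n%:R <= n%:R * n%:R :> R by rewrite ler_wpM2r.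
    by lra.
  have : 0 <= N%:R :> R by [].
  by move: h3 h4 h2; move: (m1%:R : R) (N%:R : R) (9 / 10 * n%:R * n%:R) => m M x; lra.
have -> : 30 / L = 20 / L + 10 / L by rewrite -mulrDl -natrD.
exact: lerD.
Qed.

End Isolated.

(** * Overly dense pairs of vertex sets at the later time *)

Section DensePairs.
Variables (R : realType) (n : nat).
Local Notation L := (@ln R n%:R).
Local Notation K := (complete n).
Local Notation tuples := ('C(n, 2).-tuple {set 'I_n}).
Local Notation N := ('C(n, 2)).
Local Notation m2 := (upper_time R n).
Local Notation p2 := (m2%:R / N%:R : R).
Local Notation y := (L `^ (1 / 4)).
Hypotheses (hL : 1000 <= L) (hn : 1000 * L <= n%:R).

(** The exponents of [ln n] in P4, P5 and P6 are multiples of [1/4], so real powers can be replaced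
    by natural powers of [y]. *)
Lemma powR_quarter k (r : R) : r = k%:R / 4 -> L `^ r = y ^+ k.
Proof.
move=> ->; rewrite -powR_mulrn ?powR_ge0// -powRrM; congr (_ `^ _); lra.
Qed.

Lemma quarter_pow4 : y ^+ 4 = L.
Proof.
rewrite -(@powR_quarter 4 1); last by lra.
by rewrite powRr1// ltW// (log_gt0 hL).
Qed.

Lemma quarter_ge1 : 1 <= y.
Proof.
rewrite leNgt; apply/negP => y1; have := hL; rewrite -quarter_pow4.
have : y ^+ 4 <= 1 by rewrite exprn_ile1 ?powR_ge0// ltW.
by lra.
Qed.

(** A common form of the violations of P4 and P5. Overlaps are allowed, so [W = U] with [a = 1]
    covers P4; the exact size of [W] makes the union bound depend on [#|U|] alone. *)
Definition dense_pair (G : graph n) (a k : nat) : Prop :=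
  exists U W : {set 'I_n}, [/\ (0 < #|U|)%N, #|U|%:R * y ^+ 2 <= n%:R,
    #|W| = (a * #|U|)%N & (k * #|U| <= edges_between G U W)%N].

(** Here [k * #|U|] edges are chosen among at most [a * #|U| ^ 2]. The [7] bounds [3 * p2 * n / L],
    with [3] from the binomial coefficient and [p2 * n] about [2 * L]. *)
Lemma prob_dense_fixed (U W : {set 'I_n}) a k : (0 < k)%N -> (0 < #|U|)%N ->
  #|W| = (a * #|U|)%N ->
  process_prob R (fun s : tuples => (k * #|U| <= edges_between (process s m2) U W)%N) <=
  (7 * a%:R * L * (#|U|%:R / n%:R) / k%:R) ^+ (k * #|U|).
Proof.
move=> k0 U0 cW; set u := #|U|; have hn' := n_ge1000 hL hn; have hL0 := log_gt0 hL.
have CK : cross U W \subset K by rewrite subsetIr.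
apply: le_trans (_ : process_prob R (fun s : tuples =>
    (k * u <= #|cross U W :&: process s m2|)%N) <= _).
  by apply: process_prob_mono => s hs; rewrite edges_betweenE ?process_sub.
apply: le_trans (process_prob_card_ge R (k * u) (upper_time_leN hL hn) CK) _.
have ku0 : (0 < k * u)%N by rewrite muln_gt0 k0.
have p20 : 0 <= p2 by rewrite divr_ge0.
have cC : (#|cross U W| <= u * (a * u))%N by rewrite -cW card_cross_le.
apply: le_trans (_ : 'C(u * (a * u), k * u)%:R * p2 ^+ (k * u) <= _).
  by rewrite ler_wpM2r ?exprn_ge0// ler_nat leq_bin2l.
apply: le_trans (ler_wpM2r _ (bin_le_exp R _ ku0)) _; first by rewrite exprn_ge0.
have kR : 0 < k%:R :> R by rewrite ltr0n.
have uR : 0 < u%:R :> R by rewrite ltr0n.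
rewrite -exprMn lerXn2r// ?nnegrE ?mulr_ge0 ?invr_ge0 ?(ltW hL0)//.
have p2n : p2 * n%:R * 3 <= 7 * L.
  have := upper_density_le hL hn; have : p2 * 1000 <= p2 * n%:R by rewrite ler_wpM2l.
  by move: (p2) p20 => p p0; lra.
rewrite !natrM.
have nR : n%:R != 0 :> R by rewrite gt_eqF//; lra.
rewrite (_ : 3 * _ / _ * _ = (p2 * n%:R * 3) * (a%:R * (u%:R / n%:R) / k%:R)); last first.
  have aux (p u' a' k' v : R) : u' != 0 -> k' != 0 -> v != 0 ->
      3 * (u' * (a' * u')) / (k' * u') * p = (p * v * 3) * (a' * (u' / v) / k').
    by move=> h1 h2 h3; field; rewrite h1 h2 h3.
  by apply: aux; rewrite // gt_eqF.
rewrite (_ : 7 * _ * _ * _ / _ = (7 * L) * (a%:R * (u%:R / n%:R) / k%:R)); last first.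
  by rewrite -!mulrA; congr (_ * _); rewrite mulrCA.
by rewrite ler_wpM2r// !mulr_ge0 ?invr_ge0.
Qed.

Variables (a k : nat) (D : R).
Hypotheses (a0 : (0 < a)%N) (hk : (6 * a < k)%N) (D1 : 1 <= D).
Hypotheses (hD : 7 * a%:R * L <= D * y * k%:R) (hDy : 3 * D ^+ 3 <= y).
(** With [x = #|U| / n <= y ^- 2], the base in [prob_dense_fixed] is at most
    [D * y * x <= D / y]. *)
Local Notation eta := (D / y).

Lemma eta_ge0 : 0 <= eta.
Proof. by rewrite divr_ge0 ?powR_ge0// (le_trans ler01 D1). Qed.

Lemma eta_small : 3 * D ^+ 2 * eta <= 1.
Proof.
have y0 : 0 < y by exact: lt_le_trans ltr01 quarter_ge1.
have -> : 3 * D ^+ 2 * eta = 3 * D ^+ 3 / y by rewrite [D ^+ 3]exprSr !mulrA.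
by rewrite ler_pdivrMr// [leRHS]mul1r.
Qed.

Lemma eta_le : eta <= 1 / 3.
Proof.
have : 1 <= D ^+ 2 by rewrite exprn_ege1.
have := eta_small; have := eta_ge0 => e0 e1 d1.
have : 3 * 1 * eta <= 3 * D ^+ 2 * eta by rewrite ler_wpM2r// ler_wpM2l.
by lra.
Qed.

(* With x = #|U| / n this is the union bound over all pairs (U, W) of given
   sizes; of the factors b = D y x of b ^+ k, 4 a compensate for (3 / x) ^+ (2 a),
   and one of the others is kept as eta. *)
Lemma dense_count_le (x : R) (u : nat) : 0 < x -> x <= 1 -> x * y ^+ 2 <= 1 ->
  (3 / x) ^+ u * (3 / x) ^+ (a * u) * (D * y * x) ^+ (k * u) <= eta ^+ u.
Proof.
move=> x0 x1 xy; have y0 : 0 < y by exact: lt_le_trans ltr01 quarter_ge1.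
have D0 : 0 < D by exact: lt_le_trans ltr01 D1.
have e0 := eta_ge0; have e1 : eta <= 1 by have := eta_le; lra.
set b := D * y * x; have b0 : 0 <= b by rewrite !mulr_ge0// ltW.
have be : b <= eta.
  rewrite /b ler_pdivlMr//.
  have -> : D * y * x * y = D * (x * y ^+ 2) by ring.
  by rewrite ler_piMr// ltW.
have x3 : 1 <= 3 / x by rewrite ler_pdivlMr//; lra.
have z3 : 0 <= 3 / x := le_trans ler01 x3.
have nn i j : 0 <= (3 / x) ^+ i * b ^+ j by rewrite mulr_ge0// exprn_ge0.
rewrite -exprD -mulSn !exprM -exprMn lerXn2r ?nnegrE//.
apply: le_trans (_ : (3 / x) ^+ (2 * a) * (b ^+ (4 * a) * eta ^+ (2 * a).+1) <= _).
  apply: ler_pM; [exact: exprn_ge0|exact: exprn_ge0| |].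
    by rewrite ler_weXn2l//; clear -a0; lia.
  (* The [4 * a] factors [b], with [2 * a] factors [eta], cancel [(3 / x) ^ (2 * a)] because [3 / x
     * b ^ 2 * eta <= 3 * D ^ 2 * eta <= 1]. One [eta] remains, and the last group is bounded by
     [1]. *)
  have -> : k = (4 * a + ((2 * a).+1 + (k - (6 * a).+1)))%N by clear -hk; lia.
  rewrite exprD ler_wpM2l ?exprn_ge0// exprD.
  apply: le_trans (_ : b ^+ (2 * a).+1 * 1 <= _).
    by rewrite ler_wpM2l ?exprn_ge0// exprn_ile1// (le_trans be).
  by rewrite mulr1 lerXn2r ?nnegrE.
have -> : (4 * a = 2 * (2 * a))%N by rewrite mulnA.
set e := eta; rewrite -/e in e0 e1 be.
rewrite exprSr mulrA [b ^+ _]exprM mulrA -!exprMn.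
rewrite -[leRHS]mul1r ler_wpM2r// exprn_ile1//.
  by rewrite mulr_ge0// mulr_ge0// exprn_ge0.
rewrite mulrA; apply: le_trans eta_small; rewrite -/e ler_wpM2r//.
have -> : 3 / x * b ^+ 2 = 3 * D ^+ 2 * (x * y ^+ 2).
  by rewrite /b; field; rewrite gt_eqF.
by rewrite ler_piMr// mulr_ge0// exprn_ge0// ltW.
Qed.

(** In bounding the number of pairs, [n / u] also replaces the smaller [n / (a * u)], so that one
    base [3 / x] serves both sets. *)
Lemma prob_dense_size u : (0 < u)%N -> u%:R * y ^+ 2 <= n%:R ->
  process_prob R (fun s : tuples => exists2 UW : {set 'I_n} * {set 'I_n},
     (#|UW.1| == u) && (#|UW.2| == (a * u)%N) &
     (k * u <= edges_between (process s m2) UW.1 UW.2)%N) <= eta ^+ u.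
Proof.
move=> u0 uy; have hn' := n_ge1000 hL hn; have hL0 := log_gt0 hL.
have k0 : (0 < k)%N by clear -hk; lia.
have kR : 0 < k%:R :> R by rewrite ltr0n.
have uR : 0 < u%:R :> R by rewrite ltr0n.
have aR : 1 <= a%:R :> R by rewrite ler1n.
have nR : 0 < n%:R :> R by lra.
have y0 : 0 < y by exact: lt_le_trans ltr01 quarter_ge1.
have D0 : 0 < D by exact: lt_le_trans ltr01 D1.
set x : R := u%:R / n%:R.
have x0 : 0 < x by rewrite divr_gt0.
have xy : x * y ^+ 2 <= 1 by rewrite /x mulrAC ler_pdivrMr// [leRHS]mul1r.
have x1 : x <= 1.
  apply: le_trans xy; rewrite ler_peMr ?(ltW x0)// exprn_ege1//.
  exact: quarter_ge1.
apply: le_trans (process_prob_union _ _ _) _.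
apply: le_trans (_ : \sum_(UW : {set 'I_n} * {set 'I_n} |
   (#|UW.1| == u) && (#|UW.2| == (a * u)%N)) (D * y * x) ^+ (k * u) <= _).
  apply: ler_sum => -[U W] /= /andP[/eqP cU /eqP cW].
  rewrite -cU; apply: le_trans (@prob_dense_fixed U W a k k0 _ _) _.
  - by rewrite cU.
  - by rewrite cU.
  rewrite cU lerXn2r ?nnegrE ?mulr_ge0 ?invr_ge0 ?(ltW hL0) ?(ltW x0) ?(ltW y0) ?(ltW D0)//.
  rewrite mulrAC ler_wpM2r ?(ltW x0)// ler_pdivrMr//.
apply: le_trans (dense_count_le u x0 x1 xy).
rewrite big_const iter_addr_0 -[_ *+ _]mulr_natl.
rewrite ler_wpM2r ?exprn_ge0 ?mulr_ge0 ?(ltW x0) ?(ltW y0) ?(ltW D0)//.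
have -> : #|[pred UW : {set 'I_n} * {set 'I_n} | (#|UW.1| == u) && (#|UW.2| == (a * u)%N)]| =
   ('C(n, u) * 'C(n, a * u))%N.
  have dr v : 'C(n, v) = #|[set U : {set 'I_n} | #|U| == v]| by rewrite card_draws card_ord.
  rewrite !dr -cardsX; apply: eq_card => -[U W].
  by rewrite !inE.
have nx : 3 * n%:R / u%:R = 3 / x :> R.
  by rewrite /x; field; apply/andP; split; rewrite gt_eqF.
have au0 : (0 < a * u)%N by rewrite muln_gt0 a0.
rewrite natrM; apply: ler_pM => //.
  by apply: le_trans (bin_le_exp R n u0) _; rewrite nx.
apply: le_trans (bin_le_exp R n au0) _.
rewrite lerXn2r ?nnegrE ?divr_ge0 ?mulr_ge0 ?(ltW x0)//.
rewrite -nx ler_wpM2l ?mulr_ge0// lef_pV2 ?posrE ?ltr0n//.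
by rewrite ler_nat leq_pmull.
Qed.

Lemma geom_sum_le (q : R) m : 0 <= q -> q <= 1 / 2 -> \sum_(i < m) q ^+ i.+1 <= 2 * q.
Proof.
move=> q0 q1; suff : \sum_(i < m) q ^+ i.+1 + 2 * q ^+ m.+1 <= 2 * q.
  by apply: le_trans; rewrite lerDl mulr_ge0 ?exprn_ge0.
elim: m => [|m IH]; first by rewrite big_ord0 add0r.
apply: le_trans IH; rewrite big_ord_recr /= -addrA lerD2l.
have : q * q ^+ m.+1 <= 1 / 2 * q ^+ m.+1 by rewrite ler_wpM2r ?exprn_ge0.
by rewrite -exprS; lra.
Qed.

(** Sizes of [U] start at [1], so the geometric series over them is at most twice its first term
    [eta]. *)
Lemma prob_dense_pair :
  process_prob R (fun s : tuples => dense_pair (process s m2) a k) <= 2 * D / y.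
Proof.
have e0 := eta_ge0.
apply: le_trans (_ : process_prob R (fun s : tuples =>
    exists2 i : 'I_n, i.+1%:R * y ^+ 2 <= n%:R &
    exists2 UW : {set 'I_n} * {set 'I_n},
     (#|UW.1| == i.+1) && (#|UW.2| == (a * i.+1)%N) &
     (k * i.+1 <= edges_between (process s m2) UW.1 UW.2)%N) <= _).
  apply: process_prob_mono => s _ [U [W [U0 Uy cW h]]].
  have Un : (#|U|.-1 < n)%N by rewrite prednK// -[X in (_ <= X)%N]card_ord max_card.
  exists (Ordinal Un); first by rewrite /= prednK.
  by exists (U, W); rewrite /= prednK// cW !eqxx.
apply: le_trans (process_prob_union _ _ _) _.
apply: le_trans (_ : \sum_(i < n) eta ^+ i.+1 <= _).
  rewrite [leLHS]big_mkcond /=; apply: ler_sum => i _.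
  case: ifP => hi; last by rewrite exprn_ge0.
  exact: prob_dense_size.
rewrite -mulrA; apply: geom_sum_le => //.
by have := eta_le; lra.
Qed.

End DensePairs.
(** Used for P5, which bounds [#|W|] from above while [dense_pair] prescribes it. *)
Lemma superset_card (T : finType) (A : {set T}) j : (#|A| <= j <= #|T|)%N ->
  exists2 B : {set T}, A \subset B & #|B| = j.
Proof.
move=> /andP[Aj jT]; move: jT; rewrite -(subnKC Aj); elim: (j - #|A|)%N => [|i IH] h.
  by exists A; rewrite ?addn0.
have [|B AB cB] := IH; first by apply: leq_trans h; rewrite leq_add2l.
have /set0Pn[x xB] : ~: B != set0.
  rewrite -card_gt0 cardsCs setCK subn_gt0 cB; apply: leq_trans h.
  by rewrite addnS.
exists (x |: B); first by apply: subset_trans AB _; exact: subsetUr.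
by rewrite cardsU1 cB addnS; move: xB; rewrite inE => ->.
Qed.

(** * P4 and P5 from the absence of dense pairs; edge counts for P6 *)

Section EdgeDistribution.
Variables (R : realType) (n : nat).
Local Notation L := (@ln R n%:R).
Local Notation K := (complete n).
Local Notation tuples := ('C(n, 2).-tuple {set 'I_n}).
Local Notation N := ('C(n, 2)).
Local Notation m1 := (lower_time R n).
Local Notation p1 := (m1%:R / N%:R : R).
Local Notation y := (L `^ (1 / 4)).
Hypotheses (hL : 1000 <= L) (hn : 1000 * L <= n%:R).

Lemma quarter_gt0 : 0 < y.
Proof. exact: lt_le_trans ltr01 (quarter_ge1 hL). Qed.

Lemma sqrt_log : L `^ (1 / 2) = y ^+ 2.
Proof. by apply: powR_quarter; lra. Qed.

Lemma card_le_sqrt_log (u : nat) :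
  (u%:R <= n%:R / L `^ (1 / 2)) = (u%:R * y ^+ 2 <= n%:R).
Proof. by rewrite sqrt_log ler_pdivlMr// exprn_gt0// quarter_gt0. Qed.

Lemma P4_of_not_dense (G : graph n) : G \subset K ->
  ~ dense_pair R G 1 (Num.truncn (y ^+ 3)) -> P4 R G.
Proof.
move=> GK nd; rewrite /P4 => U; rewrite card_le_sqrt_log => hU.
have -> : L `^ (3 / 4) = y ^+ 3 by apply: powR_quarter; lra.
have y3 : 0 <= y ^+ 3 by rewrite exprn_ge0// ltW// quarter_gt0.
rewrite leNgt; apply/negP => h; apply: nd; exists U, U; split=> //.
- rewrite lt0n; apply/eqP => U0; move: h; rewrite U0 mul0r ltr0n => /card_gt0P[e].
  rewrite inE (cards0_eq U0) subset0 => /andP[eG /eqP e0].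
  by have := fintype.subsetP GK e eG; rewrite e0 inE cards0.
- by rewrite mul1n.
apply: leq_trans (edges_in_le_between _ GK); rewrite -(ler_nat R) natrM.
apply: le_trans (ltW h); rewrite mulrC ler_wpM2l//.
by rewrite truncn_le.
Qed.

(** The set [W] is enlarged, possibly into [U], to [a * #|U|] vertices, which exist because
    [a <= 2 * y <= y ^ 2]. The density [delta0 * L / 3] stays below [(delta0 * L - 1) / 2 <= d0 / 2]
    once [delta0 * L >= 3]. *)
Lemma P5_of_not_dense (delta0 : R) (G : graph n) : G \subset K -> 3 <= delta0 * L ->
  2 <= y -> ~ dense_pair R G (Num.truncn y).+1 (Num.truncn (delta0 * L / 3)) ->
  P5 delta0 G.
Proof.
move=> GK hd y2 nd; rewrite /P5 => U W dUW; rewrite card_le_sqrt_log => hU hW.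
set a := (Num.truncn y).+1; set k := Num.truncn (delta0 * L / 3).
have y0 := quarter_gt0.
have ya : y <= a%:R by apply/ltW/truncnS_gt.
have ay : a%:R <= y * 2.
  have : (Num.truncn y)%:R <= y by rewrite truncn_le ltW.
  have -> : a%:R = (Num.truncn y)%:R + 1 :> R by rewrite natr1.
  by lra.
have kd : k%:R <= delta0 * L / 3 by rewrite truncn_le; lra.
have d0_ge : delta0 * L - 1 <= (d0 delta0 n)%:~R.
  have /andP[_] := floor_itv (delta0 * L); rewrite intrD /d0.
  by move: ((Num.floor _)%:~R) => f; lra.
have [U0|U0] := posnP #|U|.
  have /eqP -> : edges_between G U W == 0%N.
    rewrite -leqn0 edges_betweenE//; apply: leq_trans (subset_leq_card (subsetIl _ _)) _.
    by apply: leq_trans (card_cross_le _ _) _; rewrite U0.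
  by rewrite U0 mulr0 mul0r.
have Wa : (#|W| <= a * #|U|)%N.
  rewrite -(ler_nat R) natrM mulrC; apply: le_trans hW _; rewrite ler_wpM2l//.
have an : (a * #|U| <= n)%N.
  rewrite -(ler_nat R) natrM; apply: le_trans hU; rewrite mulrC ler_wpM2l//.
  by apply: le_trans ay _; rewrite expr2 ler_wpM2l// ltW.
have [|W' WW' cW'] := @superset_card _ W (a * #|U|); first by rewrite Wa card_ord.
apply: le_trans (_ : (k * #|U|)%:R <= _).
  rewrite ler_nat; apply: leq_trans (edges_between_monoW _ _ WW') _.
  rewrite leqNgt; apply/negP => /ltnW h; apply: nd; exists U, W'; split => //.
rewrite natrM mulrAC ler_wpM2r//; move: ((d0 delta0 n)%:~R) d0_ge => f; lra.
Qed.

Hypothesis hy : 1000 <= y.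

(** The mean [p1 * w ^ 2] is at least [9/10 * n]. With [z = 1/2] the tail bound gains
    [expR (- (0.45 * n))] and loses [2 ^ (n / 2) <= expR (0.4 * n)]. *)
Lemma prob_sparse_fixed (U W : {set 'I_n}) w : [disjoint U & W] ->
  #|U| = w -> #|W| = w -> n%:R <= w%:R * y ^+ 2 -> w%:R * y ^+ 2 <= 2 * n%:R ->
  process_prob R (fun s : tuples => ~ (n%:R / 2 <= (edges_between (process s m1) U W)%:R :> R))
  <= expR (- (n%:R / 20)).
Proof.
move=> dUW cU cW w1 w2; have hn' := n_ge1000 hL hn; have hL0 := log_gt0 hL.
have nR : 0 < n%:R :> R by lra.
have y0 : 0 <= y := ltW quarter_gt0.
have y4 : L = (y ^+ 2) ^+ 2 by rewrite -exprM; exact/esym/(quarter_pow4 hL).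
have cF : #|cross U W| = (w * w)%N by rewrite card_cross// cU cW.
have w1' : n%:R ^+ 2 <= w%:R ^+ 2 * L.
  rewrite y4 -exprMn.
  by rewrite lerXn2r ?nnegrE ?mulr_ge0.
have w2' : w%:R ^+ 2 * L <= 4 * n%:R ^+ 2.
  rewrite y4 -exprMn.
  have -> : 4 * n%:R ^+ 2 = (2 * n%:R) ^+ 2 :> R by ring.
  by rewrite lerXn2r ?nnegrE ?mulr_ge0.
apply: le_trans (_ : process_prob R (fun s : tuples => (set0 : graph n) \subset process s m1 /\
   (#|cross U W :&: process s m1| <= n./2)%N) <= _).
  apply: process_prob_mono => s hs /negP; rewrite -ltNge => h; split; first exact: sub0set.
  rewrite -edges_betweenE ?process_sub//; rewrite geq_half_double -(ler_nat R) -muln2 natrM.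
  by move: h; move: (_%:R) => e; lra.
apply: le_trans (@process_prob_hit_card_le R n m1 m1 set0 (cross U W) (1 / 2) n./2
  _ (lower_time_leN hL hn) (lower_time_leN hL hn) (sub0set _) (subsetIr _ _) _ _) _.
- by apply/andP; split; lra.
- by rewrite -setI_eq0 set0I.
- rewrite cards0 add0n cF -(ler_nat R) !natrM (binn2_natr R n) -expr2.
  have : 1000 * w%:R ^+ 2 <= L * w%:R ^+ 2 :> R by rewrite ler_wpM2r// exprn_ge0.
  have : 1000 * n%:R <= n%:R * n%:R :> R by rewrite ler_wpM2r.
  by move: w2'; lra.
rewrite cards0 expr0 mulr1 cF natrM -expr2.
have pw : 9 / 10 * n%:R <= p1 * w%:R ^+ 2.
  have p10 : 0 <= p1 by rewrite divr_ge0.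
  have h1 : 9 / 10 * L * w%:R ^+ 2 <= p1 * n%:R * w%:R ^+ 2.
    by rewrite ler_wpM2r ?exprn_ge0// (lower_density_ge hL hn).
  suff : 9 / 10 * n%:R * n%:R <= p1 * w%:R ^+ 2 * n%:R by rewrite ler_pM2r.
  move: h1 w1'; rewrite [n%:R ^+ 2]expr2; move: (p1) (w%:R ^+ 2) (n%:R : R) => p v m.
  by lra.
have h2 : (1 / 2) ^- n./2 <= expR (4 / 10 * n%:R) :> R.
  apply: le_trans (_ : expR (8 / 10 : R) ^+ n./2 <= _).
    rewrite -exprVn lerXn2r ?nnegrE ?expR_ge0 ?invr_ge0 ?divr_ge0//.
    have -> : (1 / 2 : R)^-1 = 2 by field.
    (* The chain is [2 <= (11/10) ^ 8 <= expR (8/10)]. *)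
    have -> : 8 / 10 = 1 / 10 * 8%:R :> R by field.
    rewrite expRM_natr; apply: le_trans (_ : (1 + 1 / 10) ^+ 8 <= _); first by lra.
    by rewrite lerXn2r ?nnegrE ?expR_ge0// expR_ge1Dx.
  rewrite -expRM_natr ler_expR.
  have : (n./2)%:R * 2 <= n%:R :> R by rewrite -natrM muln2 ler_nat -geq_half_double.
  by move: ((n./2)%:R) => h; lra.
apply: le_trans (ler_wpM2r (expR_ge0 _) h2) _; rewrite -expRD ler_expR.
by move: pw; move: (p1) => p; lra.
Qed.

(** With [v = y ^ 2], one has [3 * n / w <= 3 * v <= expR (v / 400)], and [v * w <= 2 * n] leaves
    [expR (n / 200)] for each set. A large [y] thus keeps the number of pairs well below the
    [expR (n / 20)] gained for a fixed pair. *)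
Lemma card_pairs_le w : (0 < w)%N -> n%:R <= w%:R * y ^+ 2 -> w%:R * y ^+ 2 <= 2 * n%:R ->
  'C(n, w)%:R * 'C(n, w)%:R <= expR (n%:R / 100) :> R.
Proof.
move=> w0 w1 w2; have wR : 0 < w%:R :> R by rewrite ltr0n.
set v := y ^+ 2; have v6 : 1000 * 1000 <= v.
  by rewrite /v expr2; apply: ler_pM; [exact: ler0n|exact: ler0n|exact: hy|exact: hy].
have e3 : 3 * v <= expR (v / 400).
  have v0 : 0 <= v / 400 by lra.
  apply: le_trans (expR_ge1Dxn 1 v0).
  have : 1000 * 1000 * v <= v * v by rewrite ler_wpM2r//; lra.
  have -> : 2`!%:R = 2 :> R by [].
  by rewrite expr_div_n [v ^+ 2]expr2; lra.
have hb : 'C(n, w)%:R <= expR (n%:R / 200) :> R.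
  apply: le_trans (bin_le_exp R n w0) _.
  apply: le_trans (_ : expR (v / 400) ^+ w <= _).
    rewrite lerXn2r ?nnegrE ?expR_ge0 ?divr_ge0 ?mulr_ge0//.
    by apply: le_trans e3; rewrite ler_pdivrMr//; rewrite -mulrA ler_wpM2l// mulrC.
  rewrite -expRM_natr ler_expR; move: w2; rewrite -/v; lra.
apply: le_trans (ler_pM _ _ hb hb) _ => //.
by rewrite -expRD ler_expR; lra.
Qed.

Lemma prob_P6 : process_prob R (fun s : tuples => ~ P6 R (process s m1)) <= 100 / L.
Proof.
have hn' := n_ge1000 hL hn; have hL0 := log_gt0 hL; have y0 := quarter_gt0.
have yL : y ^+ 2 <= L.
  by rewrite -[leRHS](quarter_pow4 hL) ler_weXn2l// (quarter_ge1 hL).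
set x : R := n%:R / L `^ (1 / 2).
have y20 : 0 < y ^+ 2 by rewrite exprn_gt0.
have x0 : 0 < x by rewrite /x sqrt_log divr_gt0//; lra.
set w := `|Num.ceil x|%N.
have wE : w%:Z = Num.ceil x by rewrite /w gez0_abs// ceil_ge0; lra.
have wR : w%:R = (Num.ceil x)%:~R :> R by rewrite -wE.
have w1 : n%:R <= w%:R * y ^+ 2 by rewrite wR -ler_pdivrMr// -sqrt_log ceil_ge.
have w2 : w%:R * y ^+ 2 <= 2 * n%:R.
  rewrite -ler_pdivlMr// wR; have /andP[+ _] := ceil_itv x; rewrite intrD => h.
  have h1 : 1 <= x by rewrite /x sqrt_log ler_pdivlMr// [leLHS]mul1r; have := hn; lra.
  have -> : 2 * n%:R / y ^+ 2 = 2 * x by rewrite /x sqrt_log mulrA.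
  by move: h; move: ((Num.ceil x)%:~R) => c; lra.
have w0 : (0 < w)%N.
  by rewrite lt0n; apply/eqP => w0; move: w1; rewrite w0 mul0r; lra.
apply: le_trans (_ : process_prob R (fun s : tuples => exists2 UW : {set 'I_n} * {set 'I_n},
   [&& [disjoint UW.1 & UW.2], #|UW.1| == w & #|UW.2| == w] &
   ~ (n%:R / 2 <= (edges_between (process s m1) UW.1 UW.2)%:R :> R)) <= _).
  apply: process_prob_mono => s _ h; apply: contrapT => nh; apply: h.
  rewrite /P6 => U W dUW cU cW.
  apply: contrapT => hUW; apply: nh; exists (U, W) => //=.
  by rewrite dUW -!eqz_nat cU cW -wE !eqxx.
apply: le_trans (process_prob_union _ _ _) _.
apply: le_trans (_ : \sum_(UW : {set 'I_n} * {set 'I_n} | (#|UW.1| == w) && (#|UW.2| == w))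
    expR (- (n%:R / 20)) <= _).
  rewrite [leLHS]big_mkcond [leRHS]big_mkcond /=; apply: ler_sum => -[U W] _ /=.
  case: ifP => [/and3P[dUW cU cW]|_]; last by case: ifP; rewrite ?expR_ge0.
  by rewrite cU cW; apply: (prob_sparse_fixed dUW _ _ w1 w2); apply/eqP.
rewrite big_const iter_addr_0 -[_ *+ _]mulr_natl.
have -> : #|[pred UW : {set 'I_n} * {set 'I_n} | (#|UW.1| == w) && (#|UW.2| == w)]| =
   ('C(n, w) * 'C(n, w))%N.
  have dr v : 'C(n, v) = #|[set U : {set 'I_n} | #|U| == v]| by rewrite card_draws card_ord.
  by rewrite !dr -cardsX; apply: eq_card => -[U W]; rewrite !inE.
rewrite natrM; apply: le_trans (ler_wpM2r (expR_ge0 _) (card_pairs_le w0 w1 w2)) _.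
rewrite -expRD; apply: le_trans (_ : expR (- (n%:R / 100)) <= _).
  by rewrite ler_expR; lra.
have n100 : 0 < n%:R / 100 :> R by lra.
apply: le_trans (expRN_le_inv n100) _; rewrite invf_div ler_wpM2l// lef_pV2 ?posrE//; last by lra.
by have := hn; lra.
Qed.

End EdgeDistribution.

(** * Position of the hitting time and collection of the estimates *)

Lemma tau2_between (n : nat) (s : 'C(n, 2).-tuple {set 'I_n}) (i j : nat) :
  (2 <= n)%N -> (j <= 'C(n, 2))%N ->
  (exists v, deg (process s i) v == 0%N) -> (2 <= mindeg (process s j))%N ->
  [/\ (i <= tau2 s)%N, (tau2 s <= j)%N & (2 <= mindeg (process s (tau2 s)))%N].
Proof.
move=> n2 jN [v /eqP v0] hj; set P := fun i => (2 <= mindeg (process s i))%N.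
have hP : has P (iota 0 'C(n, 2).+1) by apply/hasP; exists j; rewrite // mem_iota.
(* The property holds at time [j], so the default value of [hitting_time] is not returned. *)
have tN : (tau2 s < 'C(n, 2).+1)%N by rewrite -[X in (_ < X)%N](size_iota 0) -has_find.
have Pt : P (tau2 s) by have := nth_find 0%N hP; rewrite nth_iota.
split=> //.
  rewrite leqNgt; apply/negP => lt; have /(mindegP _ n2) /(_ v) := Pt.
  by rewrite leqNgt (leq_ltn_trans (deg_mono _ (process_mono _ (ltnW lt))))// v0.
rewrite leqNgt; apply/negP => lt; have := before_find 0%N lt.
by rewrite nth_iota ?add0n ?ltnS// => /negbT/negP; apply.
Qed.

Section Conclusion.
Variables (R : realType) (delta0 : R).
Hypothesis hdelta : 0 < delta0 <= 1 / 1000.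

Section Fixed.
Variable n : nat.
Local Notation L := (@ln R n%:R).
Local Notation K := (complete n).
Local Notation tuples := ('C(n, 2).-tuple {set 'I_n}).
Local Notation m1 := (lower_time R n).
Local Notation m2 := (upper_time R n).
Local Notation y := (L `^ (1 / 4)).
Local Notation good G :=
  [/\ P1 R G, P2 delta0 G, P3 delta0 G & [/\ P4 R G, P5 delta0 G & P6 R G]].
Hypotheses (hL : 1000 <= L) (hn : 1000 * L <= n%:R).
Implicit Types G H : graph n.

Lemma dense_pair_mono G H a k : G \subset H -> dense_pair R G a k -> dense_pair R H a k.
Proof.
move=> GH [U [W [U0 Uy cW h]]]; exists U, W; split=> //.
exact: leq_trans h (edges_between_mono _ _ GH).
Qed.

Lemma SMALL_anti G H : G \subset H -> SMALL delta0 H \subset SMALL delta0 G.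
Proof.
move=> GH; apply/fintype.subsetP => v; rewrite !inE; apply: le_lt_trans.
by rewrite lez_nat deg_mono.
Qed.

Lemma good_of_window (s : tuples) : s \in edge_orderings n ->
  3 <= delta0 * L -> 2 <= y ->
  (exists v, deg (process s m1) v == 0%N) -> (2 <= mindeg (process s m2))%N ->
  (maxdeg (process s m2))%:R <= 10 * L -> P2 delta0 (process s m1) ->
  ~ small_path_ends delta0 s ->
  ~ dense_pair R (process s m2) 1 (Num.truncn (y ^+ 3)) ->
  ~ dense_pair R (process s m2) (Num.truncn y).+1 (Num.truncn (delta0 * L / 3)) ->
  P6 R (process s m1) -> good (process s (tau2 s)).
Proof.
move=> hs hd y2 iso md Md p2 np nd4 nd5 p6.
have n2 : (2 <= n)%N by apply: leq_trans (n_gt5 hL hn).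
have [t1 t2 mdt] := tau2_between n2 (upper_time_leN hL hn) iso md.
have G1 := process_mono s t1; have G2 := process_mono s t2.
have GK := process_sub (tau2 s) hs.
move: (process s (tau2 s)) mdt G1 G2 GK => G mdt G1 G2 GK; split; last split.
- split=> //; apply: le_trans Md; rewrite ler_nat; apply/maxdeg_leP => v.
  exact: leq_trans (deg_mono v G2) (deg_le_maxdeg _ _).
- by apply: le_trans p2; rewrite ler_nat subset_leq_card// SMALL_anti.
- move=> [x [p [/andP[pth st] sz xS lS]]]; apply: np; exists x, p; split=> //; split.
  + apply/andP; split=> //; apply: sub_path pth => a b /=.
    by move=> /(fintype.subsetP G2).
  + exact: fintype.subsetP (SMALL_anti G1) _ xS.
  + exact: fintype.subsetP (SMALL_anti G1) _ lS.
- by apply: (P4_of_not_dense hL) => //; apply: contra_not nd4; exact: dense_pair_mono.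
- by apply: (P5_of_not_dense hL) => //; apply: contra_not nd5; exact: dense_pair_mono.
- move=> U W dUW cU cW; apply: le_trans (p6 U W dUW cU cW) _.
  by rewrite ler_nat edges_between_mono.
Qed.

Hypothesis hy : 1000 <= y.
Hypotheses (hy14 : 3 * 14 ^+ 3 <= y) (hyd : 100 / delta0 <= y).
Hypothesis hyD : 3 * (84 / delta0) ^+ 3 <= y.

(** One summand for each failing event; the bounds of order [1 / L] are weakened to [1 / y], the
    rate of the bounds on dense pairs. *)
Definition failure_const : R :=
  100 + 1 + 10 + (8 * 5 ^+ 4 * 10 ^+ 5) + 30 + 28 + 2 * (84 / delta0) + 100.

Lemma delta_log_ge : 100 * y ^+ 3 <= delta0 * L.
Proof.
have d0 : 0 < delta0 by case/andP: hdelta.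
have y0 : 0 < y := quarter_gt0 hL.
rewrite -[X in delta0 * X](quarter_pow4 hL) [y ^+ 4]exprS mulrA.
have y3 : 0 <= y ^+ 3 by rewrite exprn_ge0// ltW.
rewrite ler_wpM2r//.
by rewrite [leRHS]mulrC -ler_pdivrMr.
Qed.

(** Here [D = 14]: with [k >= y ^ 3 / 2] and [L = y ^ 4], [7 * L <= 14 * y * k]. *)
Lemma prob_dense4 : process_prob R (fun s : tuples =>
  dense_pair R (process s m2) 1 (Num.truncn (y ^+ 3))) <= 28 / y.
Proof.
have y0 : 0 < y := quarter_gt0 hL; have y1 := quarter_ge1 hL.
have y3 : y <= y ^+ 3 by rewrite -[leLHS]expr1 ler_weXn2l.
have k1 : y ^+ 3 - 1 <= (Num.truncn (y ^+ 3))%:R.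
  by rewrite lerBlDr natr1; exact/ltW/truncnS_gt.
have -> : 28 / y = 2 * 14 / y by rewrite -natrM.
apply: prob_dense_pair => //.
- rewrite -(ltr_nat R) muln1; apply: lt_le_trans k1; have := hy; lra.
- by lra.
- rewrite mulr1 -[X in _ * X <= _](quarter_pow4 hL) [y ^+ 4]exprS.
  rewrite -[leRHS]mulrA.
  have : y * (y ^+ 3 / 2) <= y * (Num.truncn (y ^+ 3))%:R.
    by rewrite ler_wpM2l ?(ltW y0)//; have := hy; lra.
  by lra.
Qed.

(** Here [D = 84 / delta0]: [a <= 2 * y] and [k >= delta0 * L / 6], and [84 = 7 * 2 * 6]. *)
Lemma prob_dense5 : process_prob R (fun s : tuples =>
  dense_pair R (process s m2) (Num.truncn y).+1 (Num.truncn (delta0 * L / 3)))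
  <= 2 * (84 / delta0) / y.
Proof.
have d0 : 0 < delta0 by case/andP: hdelta.
have y0 : 0 < y := quarter_gt0 hL; have y1 := quarter_ge1 hL; have hL0 := log_gt0 hL.
have y3 : y <= y ^+ 3 by rewrite -[leLHS]expr1 ler_weXn2l.
have dL := delta_log_ge.
have k1 : delta0 * L / 3 - 1 <= (Num.truncn (delta0 * L / 3))%:R.
  by rewrite lerBlDr natr1; exact/ltW/truncnS_gt.
have k2 : delta0 * L / 6 <= (Num.truncn (delta0 * L / 3))%:R by have := hy; lra.
have a2 : (Num.truncn y).+1%:R <= 2 * y.
  have -> : (Num.truncn y).+1%:R = (Num.truncn y)%:R + 1 :> R by rewrite natr1.
  have : (Num.truncn y)%:R <= y by rewrite truncn_le ltW.
  by lra.
apply: prob_dense_pair => //.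
- rewrite -(ltr_nat R) natrM; apply: lt_le_trans k2.
  by have := hy; lra.
- by rewrite ler_pdivlMr// mul1r; case/andP: hdelta => _; lra.
- apply: le_trans (_ : 7 * (2 * y) * L <= _).
    by rewrite ler_wpM2r ?(ltW hL0)// ler_wpM2l.
  apply: le_trans (ler_wpM2l _ k2); last by rewrite mulr_ge0 ?divr_ge0 ?ltW.
  rewrite le_eqVlt; apply/orP; left; apply/eqP.
  by move: (y) L => z l; field; rewrite gt_eqF.
Qed.

Lemma prob_good_compl :
  process_prob R (fun s : tuples => ~ good (process s (tau2 s))) <= failure_const / y.
Proof.
have d0 : 0 < delta0 by case/andP: hdelta.
have y0 : 0 < y := quarter_gt0 hL; have y1 := quarter_ge1 hL; have hL0 := log_gt0 hL.
have y3 : y <= y ^+ 3 by rewrite -[leLHS]expr1 ler_weXn2l.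
have Ly : L^-1 <= y^-1.
  rewrite lef_pV2 ?posrE// -[leRHS](quarter_pow4 hL) -[leLHS]expr1.
  by rewrite ler_weXn2l.
have ext (c : R) : 0 <= c -> c / L <= c / y by move=> c0; rewrite ler_wpM2l.
apply: le_trans (_ : process_prob R (fun s : tuples =>
  ((((((~~ (2 <= mindeg (process s m2))%N \/
  ~ ((maxdeg (process s m2))%:R <= 10 * L)) \/
  ~ P2 delta0 (process s m1)) \/
  small_path_ends delta0 s) \/
  ~ exists v : 'I_n, deg (process s m1) v == 0%N) \/
  dense_pair R (process s m2) 1 (Num.truncn (y ^+ 3))) \/
  dense_pair R (process s m2) (Num.truncn y).+1 (Num.truncn (delta0 * L / 3))) \/
  ~ P6 R (process s m1)) <= _).
  apply: process_prob_mono => s hs; apply: contra_notP => h.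
  apply: good_of_window => //.
  - by have := delta_log_ge; have := hy; lra.
  - by have := hy; lra.
  - by apply: contrapT => hh; apply: h; tauto.
  - by apply: contrapT => /negP hh; apply: h; tauto.
  - by apply: contrapT => hh; apply: h; tauto.
  - by apply: contrapT => hh; apply: h; tauto.
  - by move=> hh; apply: h; tauto.
  - by move=> hh; apply: h; tauto.
  - by move=> hh; apply: h; tauto.
  - by apply: contrapT => hh; apply: h; tauto.
apply: le_trans (_ : 100 / y + 1 / y + 10 / y + (8 * 5 ^+ 4 * 10 ^+ 5) / y + 30 / y +
    28 / y + 2 * (84 / delta0) / y + 100 / y <= _); last first.
  rewrite /failure_const le_eqVlt; apply/orP; left; apply/eqP.
  move: (8 * 5 ^+ 4 * 10 ^+ 5) (84 / delta0) (y^-1) => a b c; clear; ring.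
apply: le_trans (process_prob_or _ _ _) _; apply: lerD; last first.
  by apply: le_trans (prob_P6 hL hn hy) _; exact: ext.
apply: le_trans (process_prob_or _ _ _) _; apply: lerD; last first.
  exact: prob_dense5.
apply: le_trans (process_prob_or _ _ _) _; apply: lerD; last first.
  exact: prob_dense4.
apply: le_trans (process_prob_or _ _ _) _; apply: lerD; last first.
  by apply: le_trans (prob_no_isolated hL hn) _; exact: ext.
apply: le_trans (process_prob_or _ _ _) _; apply: lerD; last first.
  apply: le_trans (prob_small_path_ends hL hn hdelta) _; apply: ext.
  by rewrite !mulr_ge0 ?exprn_ge0.
apply: le_trans (process_prob_or _ _ _) _; apply: lerD; last first.
  by apply: le_trans (prob_card_SMALL hL hn hdelta) _; exact: ext.
apply: le_trans (process_prob_or _ _ _) _; apply: lerD; last first.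
  by apply: le_trans (prob_maxdeg_upper hL hn) _; exact: ext.
by apply: le_trans (prob_mindeg_upper hL hn) _; exact: ext.
Qed.

End Fixed.

End Conclusion.

(** * Passage to the limit *)

Lemma quarter_log_ge (R : realType) (B : R) : 1 <= B ->
  exists M : R, forall n : nat, M <= n%:R -> B <= ln n%:R /\ B <= ln n%:R `^ (1 / 4).
Proof.
move=> B1; have B0 : 0 <= B := le_trans ler01 B1.
exists (expR (B ^+ 4)) => n hn.
have n0 : 0 < n%:R :> R by apply: lt_le_trans hn; rewrite expR_gt0.
have hL : B ^+ 4 <= ln n%:R by rewrite -[leLHS]expRK ler_ln ?posrE ?expR_gt0.
split; first by apply: le_trans hL; rewrite -[leLHS]expr1 ler_weXn2l.
have -> : B = (B ^+ 4) `^ (1 / 4).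
  rewrite -powR_mulrn// -powRrM (_ : 4%:R * (1 / 4) = 1 :> R) ?powRr1//.
  by field.
rewrite ge0_ler_powR ?nnegrE ?exprn_ge0 ?divr_ge0//.
by apply: le_trans hL; rewrite exprn_ge0.
Qed.

Unset Implicit Arguments.
Local Open Scope classical_set_scope.

Theorem lemma4p5 (R : realType) :
  exists eps : R, 0 < eps /\
    forall delta0 : R, 0 < delta0 -> delta0 <= eps ->
      process_prob R (fun s : 'C(n, 2).-tuple {set 'I_n} =>
        let G := process s (tau2 s) in
        [/\ P1 R G, P2 delta0 G, P3 delta0 G &
            [/\ P4 R G, P5 delta0 G & P6 R G]])
      @[n --> \oo] --> (1 : R).
Proof.
exists (1 / 1000); split=> [|delta0 d0 d1]; first by lra.
have hd : 0 < delta0 <= 1 / 1000 by rewrite d0.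
have C0 : 0 <= failure_const delta0.
  have h : 0 <= 84 / delta0 by rewrite divr_ge0// ltW.
  have h' : 0 <= 8 * 5 ^+ 4 * 10 ^+ 5 :> R by rewrite !mulr_ge0 ?exprn_ge0.
  by rewrite /failure_const; move: (84 / delta0) (8 * _ * _) h h' => a b; lra.
apply/cvgrPdist_le => e e0.
have h1 : 0 <= failure_const delta0 / e by rewrite divr_ge0// ltW.
have h2 : 0 <= 100 / delta0 by rewrite divr_ge0// ltW.
have h3 : 0 <= 3 * (84 / delta0) ^+ 3 by rewrite mulr_ge0// exprn_ge0// divr_ge0// ltW.
have h4 : 0 <= 3 * 14 ^+ 3 :> R by rewrite mulr_ge0// exprn_ge0.
pose a1 := failure_const delta0 / e; pose a2 := 100 / delta0.
pose a3 := 3 * (84 / delta0) ^+ 3; pose a4 : R := 3 * 14 ^+ 3.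
(* Once [ln n] and its fourth root exceed [B], [a1] brings the failure probability below [e], and
   [2000] yields [n = expR (ln n) >= (ln n) ^ 2 / 2 >= 1000 * ln n]. *)
pose B := 2000 + a1 + a2 + a3 + a4.
rewrite -/a1 -/a2 -/a3 -/a4 in h1 h2 h3 h4.
have [B2 Ba1 Ba2] : [/\ 2000 <= B, a1 <= B & a2 <= B].
  rewrite /B; move: a1 a2 a3 a4 h1 h2 h3 h4 {B} => a1 a2 a3 a4.
  by split; lra.
have [Ba3 Ba4] : a3 <= B /\ a4 <= B.
  rewrite /B; move: a1 a2 a3 a4 h1 h2 h3 h4 {B B2 Ba1 Ba2} => a1 a2 a3 a4.
  by split; lra.
have B1 : 1 <= B by apply: le_trans B2; rewrite ler1n.
have [M hM] := quarter_log_ge B1.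
near=> n.
have /hM[LB yB] : M <= n%:R by near: n; exact: nbhs_infty_ger.
have L2 := le_trans B2 LB; have y2 := le_trans B2 yB.
have ya1 := le_trans Ba1 yB; have ya2 := le_trans Ba2 yB.
have ya3 := le_trans Ba3 yB; have ya4 := le_trans Ba4 yB.
have L0 : 0 < ln n%:R :> R by apply: lt_le_trans L2; rewrite ltr0n.
have nE : n%:R = expR (ln n%:R) :> R.
  rewrite lnK// posrE ltr0n lt0n; apply/eqP => n0; move: L0.
  by rewrite n0 ln0// ltxx.
have hL : 1000 <= ln (n%:R : R) by apply: le_trans L2; rewrite ler_nat.
have hn : 1000 * ln n%:R <= n%:R :> R.
  rewrite [leRHS]nE; apply: le_trans (expR_ge1Dxn 1 (ltW L0)).
  have -> : 2`!%:R = 2 :> R by [].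
  have : 2000 * ln n%:R <= ln n%:R * ln n%:R :> R by rewrite ler_wpM2r// ltW.
  rewrite [ln n%:R ^+ 2]expr2; clear -R.
  by move: (ln n%:R * ln n%:R) => q; lra.
have y0 : 0 < ln (n%:R : R) `^ (1 / 4) := quarter_gt0 hL.
have hy : 1000 <= ln (n%:R : R) `^ (1 / 4) by apply: le_trans y2; rewrite ler_nat.
rewrite process_prob_compl opprB addrC subrK ger0_norm ?process_prob_ge0//.
apply: le_trans (prob_good_compl hd hL hn hy ya4 ya2 ya3) _.
by rewrite ler_pdivrMr// mulrC -ler_pdivrMr.
Unshelve. all: by end_near.
Qed.
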